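(* Let $L\subset\mathbb{P}^2_{\mathbb{C}}$ be a line and $p\in L$ a point. The general smooth plane quartic curve admitting $L$ as inflection line with inflection point $p$ is uniquely determined by its inflection lines together with $p$. That is, there is a non-empty Zariski-open subset $U$ of the projective space of plane quartics meeting $L$ at $p$ with multiplicity at least $3$ (or containing $L$) such that the following holds: if $X_1$ and $X_2$ are smooth plane quartic curves over $\mathbb{C}$, each having $L$ as inflection line with inflection point $p$, if $X_1\in U$, and if $X_1$ and $X_2$ have the same inflection lines, then $X_1=X_2$.
   Context: The ground field is $\mathbb{C}$. An inflection line of a smooth plane curve $X$ of degree $d\ge 3$ is a line meeting $X$ at some point with multiplicity at least $3$; such a point is called an inflection point of $X$. A smooth plane quartic has exactly $24$ inflection lines, counted with multiplicity. ''$X$ has $L$ as inflection line with inflection point $p$'' means that $L$ meets $X$ at $p$ with multiplicity at least $3$. *)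

(* Defs.v *)
From HB Require Import structures.
From mathcomp Require Import all_boot all_order all_algebra.
From mathcomp Require Import reals complex.
From mathcomp Require Import mpoly.

Set Implicit Arguments.
Unset Strict Implicit.
Unset Printing Implicit Defensive.

Import GRing.Theory.
Local Open Scope ring_scope.

(* Points and lines of P^2 are given by nonzero vectors of homogeneous
   coordinates, plane curves by nonzero ternary forms; in each case two
   representatives that differ by a nonzero scalar give the same object. *)
Section PlaneQuartics.
Variable K : fieldType.
Implicit Types (F : {mpoly K[3]}) (l p q : 'rV[K]_3).

Definition on_line l p : Prop := \sum_(i < 3) l 0 i * p 0 i = 0.

Definition is_plane_quartic F : Prop := F != 0 /\ F \is 4.-homog.

Definition eval_at F p : K := F.@[fun i => p 0 i].

Definition is_smooth_plane_quartic F : Prop :=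
  is_plane_quartic F /\
  (forall p, p != 0 -> eval_at F p = 0 ->
     exists i : 'I_3, eval_at (F^`M(i)) p != 0).

(* The polynomial F(p + t q) in t. *)
Definition restrict_to_line F p q : {poly K} :=
  mmap (@polyC K) (fun i => (p 0 i)%:P + (q 0 i) *: 'X) F.

(* The intersection multiplicity at p of the line l with the curve F = 0 is
   the order of vanishing at t = 0 of F(p + t q), for q a second point of l;
   it does not depend on q.  It is infinite when the curve contains l, and
   then the divisibility below holds for every m. *)
Definition meets_with_mult_ge (m : nat) F l p : Prop :=
  forall q, on_line l q -> ~~ (q <= p)%MS -> 'X^m %| restrict_to_line F p q.

Definition is_inflection_line_at F l p : Prop :=
  [/\ l != 0, p != 0, on_line l p & meets_with_mult_ge 3 F l p].

Definition is_inflection_line F l : Prop :=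
  exists p, is_inflection_line_at F l p.

Definition same_inflection_lines F1 F2 : Prop :=
  forall l, is_inflection_line F1 l <-> is_inflection_line F2 l.

Definition same_curve F1 F2 : Prop := exists2 c : K, c != 0 & F2 = c *: F1.

(* [basis 3 4] enumerates the 15 = 'C(6, 4) monomials of degree 4 in three
   variables, cf. [size_basis] and [basis_cover]. *)
Definition quartic_monomials : seq 'X_{1..3} :=
  [seq s2m t | t : 4.-tuple 'I_3 <- enum (basis 3 4)].

(* Homogeneous coordinates of a quartic in the P^14 of all plane quartics. *)
Definition quartic_coord F (i : 'I_15) : K :=
  F@_(nth 0%MM quartic_monomials i).

(* U is open in V for the topology induced by the Zariski topology of P^14,
   i.e. V \ U is the common zero locus in V of a set S of homogeneous
   polynomials in the coefficients. *)
Definition zariski_open_in (V U : {mpoly K[3]} -> Prop) : Prop :=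
  exists S : {mpoly K[15]} -> Prop,
    (forall g, S g -> g \is homog mdeg) /\
    (forall F, U F <-> V F /\ (exists2 g, S g & g.@[quartic_coord F] != 0)).

Definition quartics_with_flex l p F : Prop :=
  is_plane_quartic F /\ meets_with_mult_ge 3 F l p.

End PlaneQuartics.

(* Main.v *)
Require Import Defs.
From HB Require Import structures.
From mathcomp Require Import all_boot all_order all_fingroup all_algebra all_field.
From mathcomp Require Import zify ring.
From mathcomp Require Import reals complex.
From mathcomp Require Import mpoly.

(** A line is an inflection line of a quartic F = 0 exactly when the binary
    quartic that F induces on it has a root of multiplicity at least 3 (or is
    zero), that is, when both classical invariants of that binary quartic, I of
    degree 2 and J of degree 3, vanish.  As functions of the line, I and J are
    contravariants of F: curves S and T of degrees 4 and 6 in the dual plane,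
    whose coefficients are quadratic, respectively cubic, in those of F.  The
    inflection lines are the 4 * 6 = 24 points of S = T = 0, and F is read off
    from them in two steps.

    First, the points determine S up to a factor ([curve_multiple],
    [same_zeros_S]).  For general F the resultant of S and T, which has degree
    24, has 24 distinct roots.  If a quartic G of the dual plane vanishes at all
    24 points, then S has the same resultant with every member of the pencil
    T + l G: it has the same roots, and its top coefficient sees only forms of
    top degree, where G does not occur.  So no member of the pencil acquires a
    new intersection with S, which forces G to vanish on all of S = 0.

    Second, S determines F up to sign among the quartics that have a flex on the
    given line L at the given point p ([recover_from_S]); this is where the
    prescribed flex enters.  Such quartics have 12 coefficients, while S still
    has 14.  A unipotent change of coordinates that fixes p and L, and depends on
    S alone, brings S to a normal form; after it F is determined up to sign by S
    and three quantities X, Y and w, of which w is a function of the other two,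
    while (X, Y) is a common point of a conic, a cubic and a quartic with
    coefficients read off from S.  Eliminating Y leaves two polynomials in X whose
    only common root, for general F, is the value that belongs to F.

    What general means is in both steps that some polynomial with integer
    coefficients in the coefficients of F, built from resultants, does not vanish
    ([generic_flexes], [generic_recovery]).  Neither polynomial is zero, because
    both are nonzero at one sample quartic modulo 29, where the resultants are
    small enough to be computed.  The homogeneous components of their product
    then define a nonempty Zariski open set with the required property. *)

Set Implicit Arguments.
Unset Strict Implicit.
Unset Printing Implicit Defensive.

Import GRing.Theory Num.Theory.
Local Open Scope ring_scope.

(** * The degree of a resultant *)

Section DegreeBound.
Variable R : idomainType.
Implicit Types (P Q : {poly R}) (c : nat -> nat -> R).

Definition top_at P d x := (size P <= d.+1)%N /\ P`_d = x.

Lemma top_atM P Q d e x y :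
  top_at P d x -> top_at Q e y -> top_at (P * Q) (d + e) (x * y).
Proof.
move=> [sP <-] [sQ <-]; split.
  apply: leq_trans (size_polyMleq _ _) _; move: sP sQ.
  by case: (size P) (size Q) => [|a] [|b] //=; lia.
rewrite coefM (bigD1 (Ordinal (leq_addr e d : d < (d + e).+1)%N)) //= addKn.
rewrite big1 ?addr0 // => i neq_i.
have [lt_id|lt_di|eq_id] := ltngtP i d; last by case/eqP: neq_i; apply/val_inj.
  rewrite [Q`_ _]nth_default ?mulr0 // (leq_trans sQ) //; lia.
by rewrite nth_default ?mul0r // (leq_trans sP).
Qed.

Lemma top_at_prod (I : finType) (P : I -> {poly R}) d x :
  (forall i, top_at (P i) (d i) (x i)) ->
  top_at (\prod_i P i) (\sum_i d i)%N (\prod_i x i).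
Proof.
move=> tP; apply: (big_rec3 (fun p e y => top_at p e y)) => [|i p e y _].
  by split; rewrite ?size_poly1 ?coef1.
exact: top_atM.
Qed.

Definition weight_lead N (r c : 'I_N -> nat) (M : 'M[{poly R}]_N) : 'M[R]_N :=
  \matrix_(i, j) (if (c j <= r i)%N then (M i j)`_(r i - c j) else 0).

(** If the entry (i, j) has degree at most r i - c j, then every term of the
    Leibniz expansion has degree at most the sum of the r i minus the sum of the
    c j, and its coefficient in that degree is the product of the coefficients of
    the entries in their own extreme degrees. *)
Lemma det_top_at N (r c : 'I_N -> nat) (M : 'M[{poly R}]_N) d :
  (\sum_i r i = \sum_i c i + d)%N ->
  (forall i j, M i j != 0 ->
     (c j <= r i)%N && (size (M i j) <= (r i - c j).+1)%N) ->
  top_at (\det M) d (\det (weight_lead r c M)).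
Proof.
move=> dE szM.
suff tops (s : 'S_N) : top_at (\prod_i M i (s i)) d (\prod_i weight_lead r c M i (s i)).
  rewrite /determinant; apply: (big_rec2 (fun p y => top_at p d y)) => [|s y p _ [sp py]].
    by split; rewrite ?size_poly0 ?coef0.
  have [st ty] := tops s.
  rewrite -[(-1) ^+ s * \prod_i M i _]/(_ *  _) -(rmorph_sign (@polyC R)) mul_polyC.
  split; last by rewrite coefD coefZ py ty.
  apply: leq_trans (size_polyD _ _) _; rewrite geq_max sp andbT.
  exact: leq_trans (size_scale_leq _ _) st.
have [/forallP/= nzM|] := boolP [forall i, M i (s i) != 0]; last first.
  rewrite negb_forall => /existsP[i /negPn/eqP Mi0].
  rewrite (bigD1 i) //= Mi0 mul0r [X in top_at _ _ X](bigD1 i) //= mxE Mi0.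
  by rewrite coef0 if_same mul0r; split; rewrite ?size_poly0 ?coef0.
have cr i : (c (s i) <= r i)%N by case/andP: (szM _ _ (nzM i)).
have -> : d = (\sum_i (r i - c (s i)))%N.
  apply/eqP; rewrite -(eqn_add2l (\sum_i c i)) -dE.
  rewrite [X in (_ == X + _)%N](reindex_inj (@perm_inj _ s)) -big_split /=.
  by apply/eqP/eq_bigr => i _; rewrite subnKC.
apply: top_at_prod => i; split; first by case/andP: (szM _ _ (nzM i)).
by rewrite mxE cr.
Qed.

End DegreeBound.

(** The outer variable is v and the inner one is u, so that the resultant of two
    such polynomials eliminates v. *)
Definition bipoly (R : nzRingType) d (c : nat -> nat -> R) : {poly {poly R}} :=
  \poly_(j < d.+1) \poly_(i < (d - j).+1) c i j.

Section Bipoly.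
Variable R : idomainType.
Implicit Types (P Q : {poly R}) (c : nat -> nat -> R).

Lemma coef_bipoly d c j :
  (bipoly d c)`_j = if (j <= d)%N then \poly_(i < (d - j).+1) c i j else 0.
Proof. by rewrite coef_poly ltnS. Qed.

Lemma coef_bipoly_lead d c : (bipoly d c)`_d = (c 0 d)%:P.
Proof.
rewrite coef_bipoly leqnn subnn; apply/polyP => i.
by rewrite coef_poly coefC; case: i.
Qed.

Lemma size_bipoly d c : c 0%N d != 0 -> size (bipoly d c) = d.+1.
Proof.
move=> nz; apply: size_poly_eq; rewrite subnn.
apply/eqP => /polyP/(_ 0%N); rewrite coef_poly coef0 /= => c0.
by rewrite c0 eqxx in nz.
Qed.

Lemma map_bipoly (R' : nzRingType) (h : {rmorphism R -> R'}) d c :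
  map_poly (map_poly h) (bipoly d c) = bipoly d (fun i j => h (c i j)).
Proof.
apply/polyP => j; rewrite coef_map /= !coef_poly; case: ifP => // _; last exact: rmorph0.
by apply/polyP => i; rewrite coef_map /= !coef_poly; case: ifP => //; rewrite rmorph0.
Qed.

(** The dimensions of [Sylvester_mx] depend on the sizes of its arguments; with
    prescribed dimensions, the matrices of different polynomials have one type
    and can be compared entry by entry. *)
Definition syl m n (p q : {poly {poly R}}) : 'M[{poly R}]_(n + m) :=
  \matrix_(i, j) match split i with
                 | inl k => p`_(j - k) *+ (k <= j)
                 | inr k => q`_(j - k) *+ (k <= j) end.

Lemma resultant_syl m n (p q : {poly {poly R}}) :
  size p = m.+1 -> size q = n.+1 -> resultant p q = \det (syl m n p q).
Proof.
move=> sp sq; rewrite /resultant.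
suff wlog_dims: forall a b (M : 'M_(a + b)), a = n -> b = m ->
    (forall i j, M i j = match split i with
                 | inl k => p`_(j - k) *+ (k <= j)
                 | inr k => q`_(j - k) *+ (k <= j) end) ->
    \det M = \det (syl m n p q).
  by apply: wlog_dims; rewrite ?sp ?sq // => i j; rewrite Sylvester_mxE.
move=> a b M ea eb; subst a b => ME; congr (\det _).
by apply/matrixP => i j; rewrite mxE ME.
Qed.

(** In the Sylvester matrix of curves of degrees m and n, the entry in row i and
    column j has degree at most the weight of row i minus j. *)
Definition syl_weight m n (i : 'I_(n + m)) : nat :=
  match split i with inl k => (m + k)%N | inr k => (n + k)%N end.

Lemma sum_syl_weight m n :
  (\sum_i @syl_weight m n i = \sum_(j < n + m) j + m * n)%N.
Proof.
rewrite !big_split_ord /= -addnA [(_ + m * n)%N]addnC addnA; congr (_ + _)%N.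
  rewrite (eq_bigr (fun k : 'I_n => m + k)%N) => [|k _]; last first.
    by rewrite /syl_weight (unsplitK (inl k)).
  by rewrite big_split /= sum_nat_const card_ord mulnC addnC.
by apply: eq_bigr => k _; rewrite /syl_weight (unsplitK (inr k)).
Qed.

(** The bound in the theorem of Bezout: the weights of the Sylvester matrix add up
    to m n. *)
Lemma resultant_bipoly m n c e : c 0%N m != 0 -> e 0%N n != 0 ->
  top_at (resultant (bipoly m c) (bipoly n e)) (m * n)
    (\det (weight_lead (@syl_weight m n) (@nat_of_ord _)
             (syl m n (bipoly m c) (bipoly n e)))).
Proof.
move=> c0 e0; rewrite (resultant_syl (size_bipoly c0) (size_bipoly e0)).
apply: det_top_at; first by rewrite sum_syl_weight.
move=> i j; rewrite mxE /syl_weight.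
case: (split i) => k; rewrite coef_bipoly;
  case: (leqP k j) => kj; rewrite ?mulr0n ?eqxx //;
  case: ifP => jk; rewrite ?mul0rn ?eqxx // => _;
  apply/andP; split; try lia;
  by apply: leq_trans (size_poly _ _) _; lia.
Qed.

(** The coefficient in the extreme degree m n is a determinant in the leading
    forms, hence blind to terms of lower degree. *)
Lemma resultant_bipoly_eq m n c e e' : c 0%N m != 0 -> e 0%N n != 0 ->
  (forall j, (j <= n)%N -> e' (n - j)%N j = e (n - j)%N j) ->
  (resultant (bipoly m c) (bipoly n e'))`_(m * n) =
  (resultant (bipoly m c) (bipoly n e))`_(m * n).
Proof.
move=> c0 e0 ee'.
have e'0 : e' 0%N n != 0 by rewrite -(subnn n) ee' // subnn.
have [_ ->] := resultant_bipoly c0 e0; have [_ ->] := resultant_bipoly c0 e'0.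
congr (\det _); apply/matrixP => i j; rewrite !mxE /syl_weight.
case: (split i) => k //; case: ifP => // jk.
rewrite !coef_bipoly; case: (leqP k j) => // kj; case: (leqP (j - k) n) => // jkn.
rewrite (_ : (n + k - j = n - (j - k))%N); last by lia.
by rewrite !mulr1n !coef_poly ltnS leqnn ee'.
Qed.

End Bipoly.

(** * Curves through the points of a transverse intersection *)

(** The resultant of two polynomials of formal degrees m and n.  The extra factors
    make it vanish when a degree drops; thanks to them it commutes with every
    ring morphism, including those that kill a leading coefficient. *)
Definition leadres (R : nzRingType) m n (p q : {poly R}) := p`_m * q`_n * resultant p q.

Lemma map_leadres (R R' : idomainType) (h : {rmorphism R -> R'}) m n (p q : {poly R}) :
  (size p <= m.+1)%N -> (size q <= n.+1)%N ->
  h (leadres m n p q) = leadres m n (map_poly h p) (map_poly h q).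
Proof.
move=> sp sq; rewrite /leadres !rmorphM !coef_map /=.
have [->|hp] := eqVneq (h p`_m) 0; first by rewrite !mul0r.
have [->|hq] := eqVneq (h q`_n) 0; first by rewrite mulr0 !mul0r.
congr (_ * _).
have lead (s : {poly R}) k : (size s <= k.+1)%N -> h s`_k != 0 -> h (lead_coef s) != 0.
  move=> ss hs; rewrite lead_coefE; suff -> : size s = k.+1 by [].
  apply/eqP; rewrite eqn_leq ss ltnNge; apply: contra hs => hs.
  by rewrite nth_default // rmorph0.
rewrite /resultant /Sylvester_mx !size_map_poly_id0; try exact: lead hp; try exact: lead hq.
rewrite -det_map_mx map_col_mx; congr (\det (col_mx _ _));
  by apply: map_lin1_mx => v; rewrite map_poly_rV rmorphM /= map_rVpoly.
Qed.

Section Leadres.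
Variable (R : idomainType).
Implicit Types p q : {poly R}.

Lemma leadres_size m n p q : (size p <= m.+1)%N -> (size q <= n.+1)%N ->
  leadres m n p q != 0 -> size p = m.+1 /\ size q = n.+1.
Proof.
move=> sp sq; rewrite /leadres !mulf_eq0 !negb_or => /andP[/andP[p0 q0] _].
by split; apply/eqP; rewrite eqn_leq ?sp ?sq ltnNge; [move: p0|move: q0];
  apply: contra => h; rewrite nth_default.
Qed.

Lemma leadres_coprime m n p q : leadres m n p q != 0 -> (size (gcdp p q) <= 1)%N.
Proof.
by rewrite /leadres mulf_eq0 negb_or => /andP[_]; rewrite resultant_eq0 -leqNgt.
Qed.

End Leadres.

Lemma poly_nonroot (K : numDomainType) (p : {poly K}) : p != 0 -> exists x, p.[x] != 0.
Proof.
move=> nz; suff /allPn[x _ px] : ~~ all (root p) [seq i%:R | i <- iota 0 (size p)].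
  by exists x.
apply/negP => rts; have := max_poly_roots nz rts.
rewrite size_map size_iota ltnn => uniq_false; suff: false by []; apply: uniq_false.
by rewrite map_inj_uniq ?iota_uniq //; apply: mulrIn; rewrite oner_eq0.
Qed.

Lemma poly_fun_eq0 (K : numDomainType) (p : {poly K}) : (forall x, p.[x] = 0) -> p = 0.
Proof.
by move=> p0; apply/eqP/negPn/negP => /poly_nonroot[x]; rewrite p0 eqxx.
Qed.

Section Multiple.
Variable K : numClosedFieldType.
Implicit Types (c e g : nat -> nat -> K).

Lemma separable_roots (p : {poly K}) m : size p = m.+1 -> (size (gcdp p p^`()) <= 1)%N ->
  exists rs, [/\ uniq rs, size rs = m & all (root p) rs].
Proof.
move=> sp cop; have [rs prs] := closed_field_poly_normal p.
have p0 : p != 0 by rewrite -size_poly_eq0 sp.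
have l0 : lead_coef p != 0 by rewrite lead_coef_eq0.
exists rs; split.
- rewrite -separable_prod_XsubC -(eqp_separable (eqp_scale _ l0)) -prs.
  rewrite separable_poly.unlock coprimep_def eqn_leq cop /= lt0n size_poly_eq0.
  by rewrite gcdp_eq0 negb_and p0.
- by move: sp; rewrite prs size_scale // size_prod_XsubC => -[].
- by apply/allP => x xrs; rewrite prs rootZ // root_prod_XsubC.
Qed.

Lemma horner2_map (p : {poly {poly K}}) u v :
  p.[v%:P].[u] = (map_poly (horner_eval u) p).[v].
Proof. by rewrite -[v in RHS](hornerC v u) -horner_evalE horner_map. Qed.

Lemma resultant_root (p q : {poly {poly K}}) u :
  (lead_coef p).[u] != 0 -> (lead_coef q).[u] != 0 ->
  (resultant p q).[u] = 0 <->
  exists v, p.[v%:P].[u] = 0 /\ q.[v%:P].[u] = 0.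
Proof.
move=> lp lq; set ev := map_poly (horner_eval u).
have -> : (resultant p q).[u] = resultant (ev p) (ev q).
  by rewrite -[LHS]/(horner_eval u _) (@map_resultant _ _ (horner_eval u) p q lp lq).
have nzp : ev p != 0.
  by rewrite -lead_coef_eq0 lead_coef_map_eq.
split=> [/eqP|[v [pv qv]]].
  rewrite resultant_eq0 => sg; have /closed_rootP[v] : size (gcdp (ev p) (ev q)) != 1%N.
    by rewrite neq_ltn sg orbT.
  by rewrite root_gcd => /andP[/eqP pv /eqP qv]; exists v; rewrite !horner2_map.
apply/eqP; rewrite resultant_eq0 ltn_neqAle lt0n size_poly_eq0 gcdp_eq0.
rewrite negb_and nzp andbT eq_sym; apply/closed_rootP; exists v.
by rewrite root_gcd !rootE -!horner2_map pv qv eqxx.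
Qed.

Lemma bipoly_lead d c : c 0%N d != 0 -> lead_coef (bipoly d c) = (c 0%N d)%:P.
Proof. by move=> c0; rewrite lead_coefE size_bipoly // coef_bipoly_lead. Qed.

Lemma resultant_bipoly_root m n c e u : c 0%N m != 0 -> e 0%N n != 0 ->
  (resultant (bipoly m c) (bipoly n e)).[u] = 0 <->
  exists v, (bipoly m c).[v%:P].[u] = 0 /\ (bipoly n e).[v%:P].[u] = 0.
Proof. by move=> c0 e0; apply: resultant_root; rewrite bipoly_lead // hornerC. Qed.

Lemma bipolyD d c e (k : K) : bipoly d (fun i j => c i j + k * e i j) =
  bipoly d c + k%:P%:P * bipoly d e.
Proof.
apply/polyP => j; rewrite coefD coefCM !coef_bipoly.
case: ifP => _; last by rewrite mulr0 addr0.
apply/polyP => i; rewrite coefD coefCM !coef_poly.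
by case: ifP => _; rewrite ?mulr0 ?addr0.
Qed.

Lemma bipoly_widen m n g : (m <= n)%N ->
  bipoly n (fun i j => if (i + j <= m)%N then g i j else 0) = bipoly m g.
Proof.
move=> mn; apply/polyP => j; rewrite !coef_bipoly; apply/polyP => i.
case: (leqP j n) => jn; last by rewrite leqNgt (leq_ltn_trans mn jn) coef0.
rewrite coef_poly; case: (leqP j m) => jm.
  rewrite coef_poly; case: (ltnP i (m - j).+1) => ij; first by rewrite !ifT //; lia.
  by case: ifP => // _; rewrite ifN //; lia.
by rewrite coef0; case: ifP => // _; rewrite ifN //; lia.
Qed.

Section Intersection.
Variables (m n : nat) (c e g : nat -> nat -> K).
Hypotheses (m_gt0 : (0 < m)%N) (lt_mn : (m < n)%N).
Let S := bipoly m c.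
Let T := bipoly n e.
Let S0 := \poly_(j < m.+1) c 0%N j.
Let r := leadres m n S T.
Hypothesis r_sqf : leadres (m * n) (m * n).-1 r r^`() != 0.
Hypothesis S0_sqf : leadres m m.-1 S0 S0^`() != 0.

(** Let r be the resultant of S and T, a polynomial of degree m n with m n
    distinct roots.  After a multiple of S is subtracted, G has degree less than
    m in v.  For every scalar l, the resultant of S and T + l G vanishes at the
    roots of r and has the same coefficient in degree m n, so it equals r.
    Hence, wherever r(u) is nonzero, T + l G vanishes at no root v of S(u, -),
    whatever l is; this is possible only if G vanishes there.  As S(u, -) has m
    distinct roots for almost all u, this gives G = 0. *)
Lemma curve_multiple :
  (forall u v, S.[v%:P].[u] = 0 -> T.[v%:P].[u] = 0 -> (bipoly m g).[v%:P].[u] = 0) ->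
  exists k, forall i j, (i + j <= m)%N -> g i j = k * c i j.
Proof.
move=> vanish.
have rmn : r`_(m * n) != 0.
  by apply: contraNneq r_sqf; rewrite /(leadres (m * n)) => ->; rewrite !mul0r.
have r0 : r != 0 by apply: contraNneq rmn => ->; rewrite coef0.
have rE : r = (c 0%N m * e 0%N n)%:P * resultant S T.
  by rewrite /r /leadres !coef_bipoly_lead polyCM.
have /andP[c0 e0] : (c 0%N m != 0) && (e 0%N n != 0).
  by rewrite -negb_or -mulf_eq0; apply: contraNneq r0 => ce; rewrite rE ce mul0r.
have ce0 : c 0%N m * e 0%N n != 0 by rewrite mulf_neq0.
pose s := resultant S T.
have [szs _] := resultant_bipoly c0 e0; rewrite -/S -/T -/s in szs.
have szr : (size r <= (m * n).+1)%N by rewrite rE mul_polyC size_scale.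
have szr' : (size r^`() <= (m * n).-1.+1)%N.
  by rewrite prednK ?muln_gt0 ?m_gt0 ?(leq_trans _ lt_mn) // -ltnS (leq_trans (lt_size_deriv r0)).
have [szr1 _] := leadres_size szr szr' r_sqf.
have [rs [urs szrs /allP rrs]] := separable_roots szr1 (leadres_coprime r_sqf).
have rootr u : r.[u] = 0 <-> s.[u] = 0.
  rewrite rE hornerM hornerC; split=> [/eqP|->]; last by rewrite mulr0.
  by rewrite mulf_eq0 (negPf ce0) => /eqP.
pose k := g 0%N m / c 0%N m; exists k.
pose g' i j := g i j + - k * c i j.
have g'E : bipoly m g' = bipoly m g + (- k)%:P%:P * S by rewrite /g' bipolyD.
have vanish' u v : S.[v%:P].[u] = 0 -> T.[v%:P].[u] = 0 -> (bipoly m g').[v%:P].[u] = 0.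
  move=> Suv Tuv; rewrite g'E !hornerE /= Suv mulr0 addr0; exact: vanish.
(* The pencil T + l G, as a family of polynomials of formal degree n. *)
pose w i j := if (i + j <= m)%N then g' i j else 0.
pose e' l i j := e i j + l * w i j.
have TE l : bipoly n (e' l) = T + l%:P%:P * bipoly m g'.
  by rewrite /e' bipolyD /w bipoly_widen // ltnW.
have e'top l j : (j <= n)%N -> e' l (n - j)%N j = e (n - j)%N j.
  by move=> jn; rewrite /e' /w subnK // ifN ?mulr0 ?addr0 // -ltnNge.
have e'0 l : e' l 0%N n != 0 by rewrite -(subnn n) e'top // subnn.
have resE l : resultant S (bipoly n (e' l)) = s.
  apply/eqP; rewrite -subr_eq0; apply/negPn/negP => nz.
  have [szl _] := resultant_bipoly c0 (e'0 l).
  have szd : (size (resultant S (bipoly n (e' l)) - s)%R <= m * n)%N.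
    apply/leq_sizeP => j.
    rewrite leq_eqVlt => /predU1P[<-|lt]; rewrite coefB.
      by rewrite (resultant_bipoly_eq c0 e0 (e'top l)) subrr.
    by rewrite !nth_default ?subrr // ?(leq_trans szs) ?(leq_trans szl).
  have root_s : all (root (resultant S (bipoly n (e' l)) - s)) rs.
    apply/allP => u /rrs/rootP/rootr su; apply/rootP; rewrite !hornerE su subr0.
    apply/(resultant_bipoly_root u c0 (e'0 l)).
    have [v [Sv Tv]] := (resultant_bipoly_root u c0 e0).1 su.
    exists v; split=> //; rewrite TE !hornerE /= Tv vanish' //; by rewrite mulr0 addr0.
  by have := max_poly_roots nz root_s urs; rewrite szrs ltnNge szd.
have vanish2 u v : r.[u] != 0 -> S.[v%:P].[u] = 0 -> (bipoly m g').[v%:P].[u] = 0.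
  move=> ru Suv; apply/eqP/contraT => g'uv; case/negP: ru; apply/eqP/rootr.
  (* The member of the pencil that passes through the point (u, v). *)
  rewrite -(resE (- T.[v%:P].[u] / (bipoly m g').[v%:P].[u])).
  apply/(resultant_bipoly_root u c0 (e'0 _)); exists v; split => //.
  by rewrite TE !hornerE /= divfK // subrr.
(* The u at which S(u, -) has a multiple root are the roots of d. *)
pose d := resultant S S^`().
have szS : size S = m.+1 by rewrite size_bipoly.
have leadS u : (lead_coef S).[u] != 0 by rewrite bipoly_lead // hornerC.
have leadS' u : (lead_coef S^`()).[u] != 0.
  have cS' : S^`()`_m.-1 = ((c 0%N m) *+ m)%:P.
    by rewrite coef_deriv prednK // coef_bipoly_lead polyCMn.
  have cm0 : c 0%N m *+ m != 0 by rewrite mulrn_eq0 negb_or -lt0n m_gt0.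
  rewrite lead_coefE (_ : (size S^`()).-1 = m.-1) ?cS' ?hornerC //.
  have S'0 : S^`() != 0.
    by apply: contraNneq cm0 => S'0; move: cS'; rewrite S'0 coef0 => /esym/eqP; rewrite polyC_eq0.
  have S0n : S != 0 by rewrite -size_poly_eq0 szS.
  have := lt_size_deriv S0n; rewrite szS ltnS => szS'.
  congr _.-1; apply/eqP; rewrite eqn_leq szS' leqNgt -{1}(prednK m_gt0) ltnS.
  apply: contra cm0 => sz; move: cS'; rewrite nth_default //.
  by move=> /esym/eqP; rewrite polyC_eq0.
have dE u : d.[u] = resultant (map_poly (horner_eval u) S) (map_poly (horner_eval u) S)^`().
  by rewrite deriv_map -(@map_resultant _ _ (horner_eval u) _ _ (leadS u) (leadS' u)).
have d0 : d != 0.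
  apply: contraNneq S0_sqf => d0; rewrite /leadres; suff -> : resultant S0 S0^`() = 0 by rewrite mulr0.
  suff -> : S0 = map_poly (horner_eval 0) S by rewrite -dE d0 horner0.
  apply/polyP => j; rewrite coef_map coef_poly coef_bipoly ltnS; case: ifP => _ /=.
    by rewrite /horner_eval horner_coef0 coef_poly.
  by rewrite /horner_eval horner0.
suff g'0 : bipoly m g' = 0.
  move=> i j ij; have /polyP/(_ j)/polyP/(_ i) := g'0.
  have jm : (j <= m)%N := leq_trans (leq_addl i j) ij.
  rewrite coef_bipoly jm !coef0 coef_poly ltnS leq_subRL // addnC ij.
  by rewrite /g' mulNr => /eqP; rewrite subr_eq0 => /eqP.
apply/polyP => j; rewrite coef0.
suff : r * d * (bipoly m g')`_j = 0.
  have rd0 : r * d != 0 by rewrite mulf_neq0.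
  by move/eqP; rewrite mulf_eq0 (negPf rd0) => /eqP.
apply: poly_fun_eq0 => u; rewrite hornerM [(r * d).[u]]hornerM.
have [->|ru] := eqVneq r.[u] 0; first by rewrite !mul0r.
have [->|du] := eqVneq d.[u] 0; first by rewrite mulr0 !mul0r.
have [rs' [urs' szrs' /allP rrs']] : exists rs,
    [/\ uniq rs, size rs = m & all (root (map_poly (horner_eval u) S)) rs].
  apply: separable_roots.
    by rewrite size_map_poly_id0 //; apply: leadS.
  by rewrite leqNgt -resultant_eq0 -dE.
suff : map_poly (horner_eval u) (bipoly m g') = 0.
  move/polyP/(_ j); rewrite coef_map coef0 /= horner_evalE => ->; exact: mulr0.
apply/eqP/negPn/negP => nz; have := max_poly_roots nz _ urs'.
rewrite szrs' ltnNge => /(_ _)/negP; apply.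
  apply/allP => v /rrs'; rewrite !rootE -!horner2_map => /eqP Suv.
  by apply/eqP/vanish2.
apply/leq_sizeP => i; rewrite leq_eqVlt => /predU1P[<-|lt]; rewrite coef_map /=.
  rewrite coef_bipoly_lead /horner_eval hornerC /g' /k mulNr divfK ?subrr //.
by rewrite coef_bipoly leqNgt lt /horner_eval horner0.
Qed.
End Intersection.
End Multiple.

(** * The contravariants S and T of a quartic with a flex *)

(** A quartic that meets the line z = 0 at the point (1 : 0 : 0) with multiplicity
    at least 3 has no terms in x^4, x^3 y and x^2 y^2.  The field fijk is its
    coefficient of x^i y^j z^k divided by the multinomial coefficient. *)
Record flex_form (R : Type) := FlexForm
  { f130 : R; f040 : R; f301 : R; f211 : R; f121 : R; f031 : R;
    f202 : R; f112 : R; f022 : R; f103 : R; f013 : R; f004 : R }.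

Definition map_flex (R R' : Type) (h : R -> R') (f : flex_form R) : flex_form R' :=
  let: FlexForm a b l m s r n q c h1 k e := f in
  FlexForm (h a) (h b) (h l) (h m) (h s) (h r) (h n) (h q) (h c) (h h1) (h k) (h e).

Section Contravariants.
Variable R : comNzRingType.

(** The coefficient of u^i v^j in the invariant I of the quartic restricted to the
    line z = u x + v y.  A priori the degree in u, v is 8; the terms of degree
    above 4 cancel because I is a contravariant, see [horner_flex_S]. *)
Definition s_coef (f : flex_form R) (i j : nat) : R :=
  let: FlexForm a b l m s r n q c h k e := f in
  match i, j with
  | 0, 1 => - (4 * a * l)
  | 0, 2 => - (12 * l * s) + 12 * m ^+ 2
  | 0, 3 => - (12 * l * q) + 12 * m * n
  | 0, 4 => - (4 * h * l) + 3 * n ^+ 2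
  | 1, 0 => - (12 * a * m) + 4 * b * l
  | 1, 1 => - (12 * a * n) + 12 * l * r - 12 * m * s
  | 1, 2 => 12 * c * l + 12 * m * q - 24 * n * s
  | 1, 3 => 12 * h * m + 4 * k * l - 12 * n * q
  | 2, 0 => - (12 * a * q) + 6 * b * n - 12 * m * r + 12 * s ^+ 2
  | 2, 1 => - (12 * a * h) - 24 * c * m + 12 * n * r + 12 * q * s
  | 2, 2 => 6 * c * n - 12 * h * s - 12 * k * m + 12 * q ^+ 2
  | 3, 0 => - (4 * a * k) + 4 * b * h + 12 * c * s - 12 * q * r
  | 3, 1 => - (4 * a * e) - 12 * c * q + 4 * h * r + 12 * k * s
  | 4, 0 => b * e + 3 * c ^+ 2 - 4 * k * r
  | _, _ => 0
  end.

(** The same for the invariant J, see [horner_flex_T]. *)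
Definition t_coef (f : flex_form R) (i j : nat) : R :=
  let: FlexForm a b l m s r n q c h k e := f in
  match i, j with
  | 0, 2 => 4 * a * l * m - b * l ^+ 2
  | 0, 3 => 2 * a * l * n + 12 * l * m * s - 4 * l ^+ 2 * r - 8 * m ^+ 3
  | 0, 4 => - (6 * c * l ^+ 2) + 12 * l * m * q + 6 * l * n * s - 12 * m ^+ 2
    * n
  | 0, 5 => 4 * h * l * m - 4 * k * l ^+ 2 + 6 * l * n * q - 6 * m * n ^+ 2
  | 0, 6 => - (e * l ^+ 2) + 2 * h * l * n - n ^+ 3
  | 1, 0 => - (4 * a ^+ 2 * l)
  | 1, 1 => - (20 * a * l * s) + 12 * a * m ^+ 2 + 2 * b * l * m
  | 1, 2 => - (16 * a * l * q) + 18 * a * m * n - 2 * b * l * n + 12 * l * m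
    * r - 24 * l * s ^+ 2 + 12 * m ^+ 2 * s
  | 1, 3 => - (4 * a * h * l) + 6 * a * n ^+ 2 + 24 * c * l * m - 6 * l * n *
    r - 36 * l * q * s + 30 * m * n * s - 12 * m ^+ 2 * q
  | 1, 4 => - (6 * c * l * n) - 8 * h * l * s - 12 * h * m ^+ 2 + 20 * k * l
    * m - 12 * l * q ^+ 2 + 6 * m * n * q + 12 * n ^+ 2 * s
  | 1, 5 => 6 * e * l * m - 4 * h * l * q - 6 * h * m * n - 2 * k * l * n + 6
    * n ^+ 2 * q
  | 2, 0 => - (8 * a * l * r) + 12 * a * m * s - 6 * a ^+ 2 * n + 8 * b * l *
    s - 9 * b * m ^+ 2
  | 2, 1 => - (22 * a * c * l) + 36 * a * m * q - 24 * a * n * s + 10 * b * l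
    * q - 6 * b * m * n + 12 * l * r * s + 12 * m * s ^+ 2 - 24 * m ^+ 2 * r
  | 2, 2 => 24 * a * h * m - 20 * a * k * l - 6 * a * n * q + 2 * b * h * l -
    3 * b * n ^+ 2 - 6 * c * l * s - 30 * c * m ^+ 2 + 24 * l * q * r - 6 * m
    * n * r + 48 * m * q * s - 30 * n * s ^+ 2
  | 2, 3 => - (6 * a * e * l) + 6 * a * h * n + 18 * c * l * q + 6 * c * m *
    n + 4 * h * l * r + 36 * h * m * s - 16 * k * l * s - 24 * k * m ^+ 2 +
    12 * m * q ^+ 2 - 30 * n * q * s - 6 * n ^+ 2 * r
  | 2, 4 => 2 * c * h * l - 3 * c * n ^+ 2 - 6 * e * l * s - 9 * e * m ^+ 2 +
    12 * h * m * q + 6 * h * n * s + 4 * k * l * q + 6 * k * m * n - 12 * n *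
    q ^+ 2
  | 3, 0 => 6 * a * c * m - 12 * a * n * r + 12 * a * q * s - 4 * a ^+ 2 * h
    + 4 * b * c * l - 18 * b * m * q + 12 * b * n * s - 4 * l * r ^+ 2 + 12 *
    m * r * s - 8 * s ^+ 3
  | 3, 1 => - (30 * a * c * n) - 12 * a * h * s + 16 * a * k * m + 24 * a * q
    ^+ 2 - 10 * b * h * m + 6 * b * k * l + 6 * b * n * q - 6 * c * l * r +
    30 * c * m * s - 36 * m * q * r + 24 * n * r * s - 12 * q * s ^+ 2
  | 3, 2 => 10 * a * e * m + 12 * a * h * q - 22 * a * k * n + 2 * b * e * l
    - 2 * b * h * n - 30 * c * m * q + 6 * c * n * s - 6 * c ^+ 2 * l - 16 *
    h * m * r - 24 * h * s ^+ 2 + 4 * k * l * r + 36 * k * m * s + 18 * n * q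
    * r + 12 * q ^+ 2 * s
  | 3, 3 => - (4 * a * e * n) + 4 * a * h ^+ 2 - 6 * c * h * m - 2 * c * k *
    l + 12 * c * n * q + 2 * e * l * r + 18 * e * m * s - 2 * h * n * r - 12
    * h * q * s - 12 * k * m * q - 6 * k * n * s + 8 * q ^+ 3
  | 4, 0 => 6 * a * c * q - 8 * a * h * r + 4 * a * k * s - a ^+ 2 * e + 6 *
    b * c * n + 8 * b * h * s - 6 * b * k * m - 9 * b * q ^+ 2 + 6 * c * m *
    r - 12 * c * s ^+ 2 - 6 * n * r ^+ 2 + 12 * q * r * s
  | 4, 1 => - (18 * a * c * h) - 2 * a * e * s + 20 * a * k * q - 4 * b * e *
    m - 2 * b * h * q + 6 * b * k * n - 6 * c * n * r + 6 * c * q * s + 12 *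
    c ^+ 2 * m + 20 * h * r * s - 8 * k * m * r - 12 * k * s ^+ 2 - 12 * q ^+
    2 * r
  | 4, 2 => 8 * a * e * q - 8 * a * h * k + b * e * n - b * h ^+ 2 + 6 * c *
    h * s + 6 * c * k * m - 12 * c * q ^+ 2 - 3 * c ^+ 2 * n - 6 * e * m * r
    - 9 * e * s ^+ 2 + 4 * h * q * r + 2 * k * n * r + 12 * k * q * s
  | 5, 0 => 2 * a * c * k - 2 * a * e * r + 4 * b * c * h + 2 * b * e * s - 6
    * b * k * q + 6 * c * q * r - 6 * c ^+ 2 * s - 4 * h * r ^+ 2 + 4 * k * r
    * s
  | 5, 1 => - (4 * a * c * e) + 4 * a * k ^+ 2 - 2 * b * e * q + 2 * b * h *
    k - 2 * c * h * r - 6 * c * k * s + 6 * c ^+ 2 * q + 6 * e * r * s - 4 *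
    k * q * r
  | 6, 0 => b * c * e - b * k ^+ 2 + 2 * c * k * r - c ^+ 3 - e * r ^+ 2
  | _, _ => 0
  end.

Arguments s_coef f (i j)%_N.
Arguments t_coef f (i j)%_N.

Definition flex_S f := bipoly 4 (s_coef f).
Definition flex_T f := bipoly 6 (t_coef f).

Definition quartic_I (b : nat -> R) := b 0%N * b 4%N - 4 * b 1%N * b 3%N + 3 * b 2%N ^+ 2.
Definition quartic_J (b : nat -> R) :=
  b 0%N * b 2%N * b 4%N + 2 * b 1%N * b 2%N * b 3%N - b 2%N ^+ 3 - b 0%N * b 3%N ^+ 2 - b 1%N ^+ 2 * b 4%N.

(** The restriction to the line z = u x + v y, as the coefficients of a binary
    quartic in x, y divided by binomial coefficients. *)
Definition on_dual_line (f : flex_form R) (u v : R) (i : nat) : R :=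
  let: FlexForm a b l m s r n q c h k e := f in
  match i with
  | 0 => e * u ^+ 4 + 4 * h * u ^+ 3 + 4 * l * u + 6 * n * u ^+ 2
  | 1 => e * u ^+ 3 * v + 3 * h * u ^+ 2 * v + k * u ^+ 3 + l * v + 3 * m * u
         + 3 * n * u * v + 3 * q * u ^+ 2
  | 2 => c * u ^+ 2 + e * u ^+ 2 * v ^+ 2 + 2 * h * u * v ^+ 2 + 2 * k * u ^+ 2 * v
         + 2 * m * v + n * v ^+ 2 + 4 * q * u * v + 2 * s * u
  | 3 => a + 3 * c * u * v + e * u * v ^+ 3 + h * v ^+ 3 + 3 * k * u * v ^+ 2
         + 3 * q * v ^+ 2 + r * u + 3 * s * v
  | _ => b + 6 * c * v ^+ 2 + e * v ^+ 4 + 4 * k * v ^+ 3 + 4 * r * v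
  end.

Lemma horner_flex_S f u v :
  (flex_S f).[v%:P].[u] = quartic_I (on_dual_line f u v).
Proof.
rewrite horner_poly horner_sum !big_ord_recr big_ord0 /=.
rewrite !hornerM -!polyC_exp !hornerC !horner_poly !big_ord_recr !big_ord0 /=.
case: f => a b l m s r n q c h k e; rewrite /quartic_I /=; ring.
Qed.

Lemma horner_flex_T f u v :
  (flex_T f).[v%:P].[u] = quartic_J (on_dual_line f u v).
Proof.
rewrite horner_poly horner_sum !big_ord_recr big_ord0 /=.
rewrite !hornerM -!polyC_exp !hornerC !horner_poly !big_ord_recr !big_ord0 /=.
case: f => a b l m s r n q c h k e; rewrite /quartic_J /=; ring.
Qed.

End Contravariants.

(** * A normal form for S *)

Section Move.
Variable R : comNzRingType.

(** The effect on the coefficients of the substitution of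
    (d x0 + x x1 + y x2, d x1 + z x2, d x2) for the variables x0, x1, x2; it
    preserves the flag formed by (1 : 0 : 0) and x2 = 0. *)
Definition move_flex (d x y z : R) (f : flex_form R) : flex_form R :=
  let: FlexForm a b l m s r n q c h k e := f in
  FlexForm
    (a * d ^+ 4)
    (4 * a * d ^+ 3 * x + b * d ^+ 4)
    (d ^+ 4 * l)
    (d ^+ 3 * l * x + d ^+ 4 * m)
    (a * d ^+ 3 * z + d ^+ 2 * l * x ^+ 2 + 2 * d ^+ 3 * m * x + d ^+ 4 * s)
    (3 * a * d ^+ 2 * x * z + a * d ^+ 3 * y + b * d ^+ 3 * z + d * l * x ^+
      3 + 3 * d ^+ 2 * m * x ^+ 2 + 3 * d ^+ 3 * s * x + d ^+ 4 * r)
    (2 * d ^+ 3 * l * y + 2 * d ^+ 3 * m * z + d ^+ 4 * n)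
    (a * d ^+ 2 * z ^+ 2 + 2 * d ^+ 2 * l * x * y + 2 * d ^+ 2 * m * x * z +
      2 * d ^+ 3 * m * y + d ^+ 3 * n * x + 2 * d ^+ 3 * s * z + d ^+ 4 * q)
    (2 * a * d * x * z ^+ 2 + 2 * a * d ^+ 2 * y * z + b * d ^+ 2 * z ^+ 2 +
      c * d ^+ 4 + 2 * d * l * x ^+ 2 * y + 2 * d * m * x ^+ 2 * z + 4 * d ^+
      2 * m * x * y + d ^+ 2 * n * x ^+ 2 + 4 * d ^+ 2 * s * x * z + 2 * d ^+
      3 * q * x + 2 * d ^+ 3 * r * z + 2 * d ^+ 3 * s * y)
    (a * d * z ^+ 3 + 3 * d ^+ 2 * l * y ^+ 2 + 6 * d ^+ 2 * m * y * z + 3 *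
      d ^+ 2 * s * z ^+ 2 + 3 * d ^+ 3 * n * y + 3 * d ^+ 3 * q * z + d ^+ 4
      * h)
    (3 * a * d * y * z ^+ 2 + a * x * z ^+ 3 + b * d * z ^+ 3 + 3 * c * d ^+
      3 * z + 3 * d * l * x * y ^+ 2 + 6 * d * m * x * y * z + 3 * d * s * x
      * z ^+ 2 + 3 * d ^+ 2 * m * y ^+ 2 + 3 * d ^+ 2 * n * x * y + 3 * d ^+
      2 * q * x * z + 3 * d ^+ 2 * r * z ^+ 2 + 6 * d ^+ 2 * s * y * z + d ^+
      3 * h * x + 3 * d ^+ 3 * q * y + d ^+ 4 * k)
    (4 * a * y * z ^+ 3 + b * z ^+ 4 + 6 * c * d ^+ 2 * z ^+ 2 + 4 * d * l *
      y ^+ 3 + 12 * d * m * y ^+ 2 * z + 4 * d * r * z ^+ 3 + 12 * d * s * y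
      * z ^+ 2 + 6 * d ^+ 2 * n * y ^+ 2 + 12 * d ^+ 2 * q * y * z + 4 * d ^+
      3 * h * y + 4 * d ^+ 3 * k * z + d ^+ 4 * e).

(** The induced substitution on S: in the dual coordinates it is given by the
    adjugate of the matrix of [move_flex].  Only S enters, so two quartics with
    the same S keep the same S. *)
Definition move_s_coef (d x y z : R) (S : nat -> nat -> R) (i j : nat) : R :=
  match i, j with
  | 0, 1 => S 0%N 1%N * d ^+ 8
  | 0, 2 => 3 * S 0%N 1%N * d ^+ 7 * z + S 0%N 2%N * d ^+ 8
  | 0, 3 => 3 * S 0%N 1%N * d ^+ 6 * z ^+ 2 + 2 * S 0%N 2%N * d ^+ 7 * z + S
    0%N 3%N * d ^+ 8
  | 0, 4 => S 0%N 1%N * d ^+ 5 * z ^+ 3 + S 0%N 2%N * d ^+ 6 * z ^+ 2 + S 0%N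
    3%N * d ^+ 7 * z + S 0%N 4%N * d ^+ 8
  | 1, 0 => - (S 0%N 1%N * d ^+ 7 * x) + S 1%N 0%N * d ^+ 8
  | 1, 1 => - (6 * S 0%N 1%N * d ^+ 6 * x * z) + 3 * S 0%N 1%N * d ^+ 7 * y -
    2 * S 0%N 2%N * d ^+ 7 * x + 3 * S 1%N 0%N * d ^+ 7 * z + S 1%N 1%N * d
    ^+ 8
  | 1, 2 => - (9 * S 0%N 1%N * d ^+ 5 * x * z ^+ 2) + 6 * S 0%N 1%N * d ^+ 6
    * y * z - 6 * S 0%N 2%N * d ^+ 6 * x * z + 2 * S 0%N 2%N * d ^+ 7 * y - 3
    * S 0%N 3%N * d ^+ 7 * x + 3 * S 1%N 0%N * d ^+ 6 * z ^+ 2 + 2 * S 1%N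
    1%N * d ^+ 7 * z + S 1%N 2%N * d ^+ 8
  | 1, 3 => - (4 * S 0%N 1%N * d ^+ 4 * x * z ^+ 3) + 3 * S 0%N 1%N * d ^+ 5
    * y * z ^+ 2 - 4 * S 0%N 2%N * d ^+ 5 * x * z ^+ 2 + 2 * S 0%N 2%N * d ^+
    6 * y * z - 4 * S 0%N 3%N * d ^+ 6 * x * z + S 0%N 3%N * d ^+ 7 * y - 4 *
    S 0%N 4%N * d ^+ 7 * x + S 1%N 0%N * d ^+ 5 * z ^+ 3 + S 1%N 1%N * d ^+ 6
    * z ^+ 2 + S 1%N 2%N * d ^+ 7 * z + S 1%N 3%N * d ^+ 8
  | 2, 0 => 3 * S 0%N 1%N * d ^+ 5 * x ^+ 2 * z - 3 * S 0%N 1%N * d ^+ 6 * x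
    * y + S 0%N 2%N * d ^+ 6 * x ^+ 2 - 3 * S 1%N 0%N * d ^+ 6 * x * z + 3 *
    S 1%N 0%N * d ^+ 7 * y - S 1%N 1%N * d ^+ 7 * x + S 2%N 0%N * d ^+ 8
  | 2, 1 => 9 * S 0%N 1%N * d ^+ 4 * x ^+ 2 * z ^+ 2 - 12 * S 0%N 1%N * d ^+
    5 * x * y * z + 3 * S 0%N 1%N * d ^+ 6 * y ^+ 2 + 6 * S 0%N 2%N * d ^+ 5
    * x ^+ 2 * z - 4 * S 0%N 2%N * d ^+ 6 * x * y + 3 * S 0%N 3%N * d ^+ 6 *
    x ^+ 2 - 6 * S 1%N 0%N * d ^+ 5 * x * z ^+ 2 + 6 * S 1%N 0%N * d ^+ 6 * y
    * z - 4 * S 1%N 1%N * d ^+ 6 * x * z + 2 * S 1%N 1%N * d ^+ 7 * y - 2 * S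
    1%N 2%N * d ^+ 7 * x + 2 * S 2%N 0%N * d ^+ 7 * z + S 2%N 1%N * d ^+ 8
  | 2, 2 => 6 * S 0%N 1%N * d ^+ 3 * x ^+ 2 * z ^+ 3 - 9 * S 0%N 1%N * d ^+ 4
    * x * y * z ^+ 2 + 3 * S 0%N 1%N * d ^+ 5 * y ^+ 2 * z + 6 * S 0%N 2%N *
    d ^+ 4 * x ^+ 2 * z ^+ 2 - 6 * S 0%N 2%N * d ^+ 5 * x * y * z + S 0%N 2%N
    * d ^+ 6 * y ^+ 2 + 6 * S 0%N 3%N * d ^+ 5 * x ^+ 2 * z - 3 * S 0%N 3%N *
    d ^+ 6 * x * y + 6 * S 0%N 4%N * d ^+ 6 * x ^+ 2 - 3 * S 1%N 0%N * d ^+ 4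
    * x * z ^+ 3 + 3 * S 1%N 0%N * d ^+ 5 * y * z ^+ 2 - 3 * S 1%N 1%N * d ^+
    5 * x * z ^+ 2 + 2 * S 1%N 1%N * d ^+ 6 * y * z - 3 * S 1%N 2%N * d ^+ 6
    * x * z + S 1%N 2%N * d ^+ 7 * y - 3 * S 1%N 3%N * d ^+ 7 * x + S 2%N 0%N
    * d ^+ 6 * z ^+ 2 + S 2%N 1%N * d ^+ 7 * z + S 2%N 2%N * d ^+ 8
  | 3, 0 => - (3 * S 0%N 1%N * d ^+ 3 * x ^+ 3 * z ^+ 2) + 6 * S 0%N 1%N * d
    ^+ 4 * x ^+ 2 * y * z - 3 * S 0%N 1%N * d ^+ 5 * x * y ^+ 2 - 2 * S 0%N
    2%N * d ^+ 4 * x ^+ 3 * z + 2 * S 0%N 2%N * d ^+ 5 * x ^+ 2 * y - S 0%N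
    3%N * d ^+ 5 * x ^+ 3 + 3 * S 1%N 0%N * d ^+ 4 * x ^+ 2 * z ^+ 2 - 6 * S
    1%N 0%N * d ^+ 5 * x * y * z + 3 * S 1%N 0%N * d ^+ 6 * y ^+ 2 + 2 * S
    1%N 1%N * d ^+ 5 * x ^+ 2 * z - 2 * S 1%N 1%N * d ^+ 6 * x * y + S 1%N
    2%N * d ^+ 6 * x ^+ 2 - 2 * S 2%N 0%N * d ^+ 6 * x * z + 2 * S 2%N 0%N *
    d ^+ 7 * y - S 2%N 1%N * d ^+ 7 * x + S 3%N 0%N * d ^+ 8
  | 3, 1 => - (4 * S 0%N 1%N * d ^+ 2 * x ^+ 3 * z ^+ 3) + 9 * S 0%N 1%N * d
    ^+ 3 * x ^+ 2 * y * z ^+ 2 - 6 * S 0%N 1%N * d ^+ 4 * x * y ^+ 2 * z + S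
    0%N 1%N * d ^+ 5 * y ^+ 3 - 4 * S 0%N 2%N * d ^+ 3 * x ^+ 3 * z ^+ 2 + 6
    * S 0%N 2%N * d ^+ 4 * x ^+ 2 * y * z - 2 * S 0%N 2%N * d ^+ 5 * x * y ^+
    2 - 4 * S 0%N 3%N * d ^+ 4 * x ^+ 3 * z + 3 * S 0%N 3%N * d ^+ 5 * x ^+ 2
    * y - 4 * S 0%N 4%N * d ^+ 5 * x ^+ 3 + 3 * S 1%N 0%N * d ^+ 3 * x ^+ 2 *
    z ^+ 3 - 6 * S 1%N 0%N * d ^+ 4 * x * y * z ^+ 2 + 3 * S 1%N 0%N * d ^+ 5
    * y ^+ 2 * z + 3 * S 1%N 1%N * d ^+ 4 * x ^+ 2 * z ^+ 2 - 4 * S 1%N 1%N *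
    d ^+ 5 * x * y * z + S 1%N 1%N * d ^+ 6 * y ^+ 2 + 3 * S 1%N 2%N * d ^+ 5
    * x ^+ 2 * z - 2 * S 1%N 2%N * d ^+ 6 * x * y + 3 * S 1%N 3%N * d ^+ 6 *
    x ^+ 2 - 2 * S 2%N 0%N * d ^+ 5 * x * z ^+ 2 + 2 * S 2%N 0%N * d ^+ 6 * y
    * z - 2 * S 2%N 1%N * d ^+ 6 * x * z + S 2%N 1%N * d ^+ 7 * y - 2 * S 2%N
    2%N * d ^+ 7 * x + S 3%N 0%N * d ^+ 7 * z + S 3%N 1%N * d ^+ 8
  | 4, 0 => S 0%N 1%N * d * x ^+ 4 * z ^+ 3 - 3 * S 0%N 1%N * d ^+ 2 * x ^+ 3
    * y * z ^+ 2 + 3 * S 0%N 1%N * d ^+ 3 * x ^+ 2 * y ^+ 2 * z - S 0%N 1%N *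
    d ^+ 4 * x * y ^+ 3 + S 0%N 2%N * d ^+ 2 * x ^+ 4 * z ^+ 2 - 2 * S 0%N
    2%N * d ^+ 3 * x ^+ 3 * y * z + S 0%N 2%N * d ^+ 4 * x ^+ 2 * y ^+ 2 + S
    0%N 3%N * d ^+ 3 * x ^+ 4 * z - S 0%N 3%N * d ^+ 4 * x ^+ 3 * y + S 0%N
    4%N * d ^+ 4 * x ^+ 4 - S 1%N 0%N * d ^+ 2 * x ^+ 3 * z ^+ 3 + 3 * S 1%N
    0%N * d ^+ 3 * x ^+ 2 * y * z ^+ 2 - 3 * S 1%N 0%N * d ^+ 4 * x * y ^+ 2
    * z + S 1%N 0%N * d ^+ 5 * y ^+ 3 - S 1%N 1%N * d ^+ 3 * x ^+ 3 * z ^+ 2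
    + 2 * S 1%N 1%N * d ^+ 4 * x ^+ 2 * y * z - S 1%N 1%N * d ^+ 5 * x * y ^+
    2 - S 1%N 2%N * d ^+ 4 * x ^+ 3 * z + S 1%N 2%N * d ^+ 5 * x ^+ 2 * y - S
    1%N 3%N * d ^+ 5 * x ^+ 3 + S 2%N 0%N * d ^+ 4 * x ^+ 2 * z ^+ 2 - 2 * S
    2%N 0%N * d ^+ 5 * x * y * z + S 2%N 0%N * d ^+ 6 * y ^+ 2 + S 2%N 1%N *
    d ^+ 5 * x ^+ 2 * z - S 2%N 1%N * d ^+ 6 * x * y + S 2%N 2%N * d ^+ 6 * x
    ^+ 2 - S 3%N 0%N * d ^+ 6 * x * z + S 3%N 0%N * d ^+ 7 * y - S 3%N 1%N *
    d ^+ 7 * x + S 4%N 0%N * d ^+ 8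
  | _, _ => 0
  end.

Lemma s_coef_move d x y z (f : flex_form R) i j :
  s_coef (move_flex d x y z f) i j = move_s_coef d x y z (s_coef f) i j.
Proof.
case: f => a b l m s r n q c h k e.
by case: i j => [|[|[|[|[|i]]]]] [|[|[|[|[|j]]]]] //=; ring.
Qed.

(** A unipotent substitution with entries in the fraction field would do; the
    common denominator, a power of the coefficient of v in S, is moved to the
    diagonal, so that the result is polynomial in f. *)
Definition normalize (f : flex_form R) : flex_form R :=
  let S := s_coef f in let D := 3 * S 0%N 1%N in
  move_flex (D ^+ 2) (3 * S 1%N 0%N * D)
    (3 * S 1%N 0%N * S 0%N 2%N - S 1%N 1%N * D) (- (S 0%N 2%N * D)) f.

Lemma s_coef_normalize (f : flex_form R) : let S := s_coef (normalize f) in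
  [/\ S 1%N 0%N = 0, S 0%N 2%N = 0 & S 1%N 1%N = 0].
Proof. by rewrite /= !s_coef_move /=; split; ring. Qed.

End Move.

Lemma move_flex_inj (K : fieldType) (d x y z : K) : d != 0 ->
  injective (move_flex d x y z).
Proof.
move=> d0.
have d4 (p q u v : K) : p = q -> d ^+ 4 * (u - v) = p - q -> u = v.
  move=> ->; rewrite subrr => /eqP; rewrite mulf_eq0 expf_eq0 (negPf d0) /=.
  by rewrite subr_eq0 => /eqP.
move=> [a b l m s r n q c h k e] [a' b' l' m' s' r' n' q' c' h' k' e'] /= [].
move=> Ea Eb El Em Es Er En Eq Ec Eh Ek Ee.
have ? : a = a' by apply: (d4 _ _ _ _ Ea); ring.
subst a'.
have ? : b = b' by apply: (d4 _ _ _ _ Eb); ring.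
subst b'.
have ? : l = l' by apply: (d4 _ _ _ _ El); ring.
subst l'.
have ? : m = m' by apply: (d4 _ _ _ _ Em); ring.
subst m'.
have ? : s = s' by apply: (d4 _ _ _ _ Es); ring.
subst s'.
have ? : r = r' by apply: (d4 _ _ _ _ Er); ring.
subst r'.
have ? : n = n' by apply: (d4 _ _ _ _ En); ring.
subst n'.
have ? : q = q' by apply: (d4 _ _ _ _ Eq); ring.
subst q'.
have ? : c = c' by apply: (d4 _ _ _ _ Ec); ring.
subst c'.
have ? : h = h' by apply: (d4 _ _ _ _ Eh); ring.
subst h'.
have ? : k = k' by apply: (d4 _ _ _ _ Ek); ring.
subst k'.
have ? : e = e' by apply: (d4 _ _ _ _ Ee); ring.
subst e'.
by [].
Qed.

(** * Elimination *)

Section Elim.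
Variable R : comNzRingType.
Variables (f : flex_form R).
Let S := s_coef f.
Let d := f130 f * f301 f.
Let A := S 2%N 0%N.
Let C := S 1%N 2%N.
Let H := S 2%N 1%N.
Let K := S 3%N 0%N.
Let p1 := S 0%N 3%N.
Let p2 := S 0%N 4%N.
Let p3 := S 1%N 3%N.
Let p4 := S 2%N 2%N.

(** For a normal f put X = f130 f211, Y = f130 f202 and w = f130^2.  By
    [elim_identities] these satisfy equations with coefficients in d and S.  The
    first gives w; the others become a conic, a cubic and a quartic in X, Y.  The
    combination cubic + 4 X conic is linear in Y, namely Y D(X) + N(X) = 0, and
    substituting Y = - N / D in the conic and in the quartic gives G1 and G2.
    The factor d is also a function of S, as the coefficient of v in S is -4 d. *)
Definition elimD : {poly R} :=
  (2 * p1 * A * d ^+ 2)%:P - (6 * p3 * d ^+ 2)%:P * 'X - (72 * p2 * d)%:P * 'X^2.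
Definition elimN : {poly R} :=
  (8 * p1 ^+ 2)%:P * 'X^3 + (5 * p1 * C * d)%:P * 'X^2
  + ((2 * p1 * H - 12 * p2 * A) * d ^+ 2)%:P * 'X - ((p3 * A + p1 * K) * d ^+ 3)%:P.
Definition elimW : {poly R} := (A * d)%:P * elimD - 6%:P * 'X * elimN.
Definition elimG1 : {poly R} :=
  ((3 * p1 ^+ 2)%:P * 'X^2 + (2 * p1 * C * d)%:P * 'X
     + ((p1 * H - 3 * p2 * A) * d ^+ 2)%:P) * (elimD * elimD)
  - (3 * p1 * d)%:P * (elimN * elimN) + (18 * p2 * d)%:P * 'X * (elimN * elimD).
Definition elimG2 : {poly R} :=
  ((72 * p1 ^+ 2)%:P * 'X^4 + (60 * p1 * C * d)%:P * 'X^3 + (48 * p1 * H * d ^+ 2)%:P * 'X^2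
    + (36 * p1 * K * d ^+ 3)%:P * 'X + (2 * p1 * A ^+ 2 * d ^+ 3)%:P) * (elimD * elimD)
  - (A * p1 * d ^+ 2)%:P * (elimD * elimW)
  + 6%:P * (elimW * ((6 * p1 * d)%:P * 'X * elimN - (C * d ^+ 2)%:P * elimN
                      - (2 * p4 * d ^+ 3)%:P * elimD)).

Definition elimX := f130 f * f211 f.
(** The quotient (G(x + 'X) - G(x)) / 'X, where x is the value of X for f: the root
    of G that belongs to f itself is removed. *)
Definition shifted (G : {poly R}) := drop_poly 1 (G \Po ('X + elimX%:P)).
End Elim.

Section Size.
Variable R : nzRingType.
Implicit Types p q : {poly R}.
Lemma size_leD n p q : (size p <= n)%N -> (size q <= n)%N -> (size (p + q)%R <= n)%N.
Proof. by move=> sp sq; rewrite (leq_trans (size_polyD _ _)) // geq_max sp. Qed.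
Lemma size_leN n p : (size p <= n)%N -> (size (- p)%R <= n)%N.
Proof. by rewrite size_polyN. Qed.
Lemma size_leM a b n p q : (size p <= a.+1)%N -> (size q <= b.+1)%N -> (a + b < n)%N ->
  (size (p * q)%R <= n)%N.
Proof.
move=> sp sq abn; apply: leq_trans (size_polyMleq _ _) _.
move: sp sq; case: (size p) (size q) => [|x] [|y]; lia.
Qed.
Lemma size_leC n (c : R) : (0 < n)%N -> (size c%:P <= n)%N.
Proof. by move=> n0; rewrite (leq_trans (size_polyC_leq1 c)). Qed.
Lemma size_leCX n k (c : R) : (k < n)%N -> (size (c%:P * 'X^k)%R <= n)%N.
Proof.
move=> kn; rewrite mul_polyC (leq_trans (size_scale_leq _ _)) //.
by rewrite size_polyXn.
Qed.
Lemma size_leCX1 n (c : R) : (1 < n)%N -> (size (c%:P * 'X)%R <= n)%N.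
Proof. by rewrite -['X]expr1; apply: size_leCX. Qed.
End Size.

Ltac size_bound := repeat first
  [ apply: size_leD | apply: size_leN | by apply: size_leC | by apply: size_leCX
  | by apply: size_leCX1 ].

Section ElimSize.
Variable R : comNzRingType.
Variable f : flex_form R.

Lemma size_elimD : (size (elimD f) <= 3)%N.
Proof. by rewrite /elimD; size_bound. Qed.

Lemma size_elimN : (size (elimN f) <= 4)%N.
Proof. by rewrite /elimN; size_bound. Qed.

Lemma size_elimW : (size (elimW f) <= 5)%N.
Proof.
rewrite /elimW; size_bound.
  by apply: (size_leM (size_leC _ (ltn0Sn 0)) size_elimD).
by apply: (size_leM (size_leCX1 _ (ltnSn 1)) size_elimN).
Qed.

Lemma size_elimG1 : (size (elimG1 f) <= 7)%N.
Proof.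
rewrite /elimG1; size_bound.
- apply: (@size_leM _ 2 4) => //; first by size_bound.
  exact: (size_leM size_elimD size_elimD).
- apply: (@size_leM _ 0 6) => //; first by size_bound.
  exact: (size_leM size_elimN size_elimN).
apply: (@size_leM _ 1 5) => //; first by size_bound.
exact: (size_leM size_elimN size_elimD).
Qed.

Lemma size_elimG2 : (size (elimG2 f) <= 9)%N.
Proof.
rewrite /elimG2; size_bound.
- apply: (@size_leM _ 4 4) => //; first by size_bound.
  exact: (size_leM size_elimD size_elimD).
- apply: (@size_leM _ 0 6) => //; first by size_bound.
  exact: (size_leM size_elimD size_elimW).
apply: (@size_leM _ 0 8) => //; first by size_bound.
apply: (size_leM size_elimW (b := 4)) => //; size_bound.
- exact: (size_leM (size_leCX1 _ (ltnSn 1)) size_elimN).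
- exact: (size_leM (size_leC _ (ltn0Sn 0)) size_elimN).
exact: (size_leM (size_leC _ (ltn0Sn 0)) size_elimD).
Qed.

End ElimSize.

Section Shifted.
Variable R : idomainType.
Implicit Types (f : flex_form R) (G : {poly R}).

Lemma size_shifted f G n : (size G <= n.+1)%N -> (size (shifted f G) <= n)%N.
Proof.
by move=> sG; rewrite size_drop_poly leq_subLR size_comp_poly2 ?size_XaddC.
Qed.

Lemma shiftedE f G y :
  G.[elimX f + y] = G.[elimX f] + y * (shifted f G).[y].
Proof.
set Gx := G \Po ('X + (elimX f)%:P).
have GxE z : Gx.[z] = G.[elimX f + z] by rewrite horner_comp !hornerE addrC.
rewrite -GxE -[X in G.[X]]addr0 -GxE horner_coef0 mulrC.
rewrite -[in LHS](poly_take_drop 1 Gx) hornerD hornerM hornerXn.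
by rewrite /take_poly horner_poly big_ord_recr big_ord0 /= add0r mulr1.
Qed.

End Shifted.

Section ElimRoots.
Variable K : numFieldType.
Implicit Types f : flex_form K.

Definition normal f := let S := s_coef f in
  [/\ S 1%N 0%N = 0, S 0%N 2%N = 0 & S 1%N 1%N = 0].

(** Normality expresses f040, f121 and f031 through f130, f301, f211 and f202;
    f112, f022, f103 and f013 are then eliminated with the coefficients of
    u^2, u v^2, u^2 v and u^3 in S. *)
Lemma elim_identities f : f130 f != 0 -> f301 f != 0 -> normal f ->
  let S := s_coef f in let d := f130 f * f301 f in
  let X := elimX f in let Y := f130 f * f202 f in let w := f130 f ^+ 2 in
  [/\ S 0%N 3%N * w = S 2%N 0%N * d + 6 * X * Y,
     3 * d * S 0%N 4%N * w = 3 * S 0%N 3%N * X ^+ 2 + 2 * S 1%N 2%N * d * X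
       + S 2%N 1%N * d ^+ 2 - 3 * d * Y ^+ 2,
     d ^+ 2 * S 1%N 3%N * w = 2 * S 0%N 3%N * w * Y * d
       - (4 * S 0%N 3%N * X ^+ 3 + 3 * S 1%N 2%N * d * X ^+ 2 + 2 * S 2%N 1%N * d ^+ 2 * X
          + S 3%N 0%N * d ^+ 3)
   & 12 * d ^+ 3 * S 2%N 2%N * w = 72 * S 0%N 3%N * X ^+ 4 + 60 * S 1%N 2%N * d * X ^+ 3
       + 48 * S 2%N 1%N * d ^+ 2 * X ^+ 2 + 36 * S 3%N 0%N * d ^+ 3 * X
       + 2 * S 2%N 0%N ^+ 2 * d ^+ 3 - S 2%N 0%N * S 0%N 3%N * w * d ^+ 2
       + 6 * S 1%N 2%N * Y * w * d ^+ 2 - 36 * S 0%N 3%N * X * Y * w * d].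
Proof.
case: f => a b l m s r n q c h k e; rewrite /normal /elimX /= => a0 l0 [E1 E2 E3].
have nz12 : 12 != 0 :> K by rewrite pnatr_eq0.
have nz4 : 4 != 0 :> K by rewrite pnatr_eq0.
have cancel t x y z : t != 0 -> t * (l * (x - y)) = z -> z = 0 -> x = y :> K.
  move=> t0 <- /eqP; rewrite !mulf_eq0 (negPf t0) (negPf l0) /= subr_eq0.
  by move/eqP.
(* With M = m / l and N = n / l everything becomes polynomial in a, l, M, N. *)
have [M mE] : exists M, m = l * M by exists (m / l); rewrite mulrC divfK.
have [N nE] : exists N, n = l * N by exists (n / l); rewrite mulrC divfK.
rewrite {}mE {}nE in E1 E2 E3 *.
have -> : b = 3 * a * M by apply: (cancel _ _ _ _ nz4 _ E1); ring.
have sE : s = l * M ^+ 2.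
  by apply/esym; apply: (cancel _ _ _ _ nz12 _ E2); ring.
have -> : r = l * M ^+ 3 + a * N.
  by apply: (cancel _ _ _ _ nz12 _ E3); rewrite sE; ring.
by rewrite {}sE; split; ring.
Qed.

End ElimRoots.

(** The elimination of w and Y; D, N and W are abstracted from their formulas once
    the linear equation N = - Y D is known. *)
Lemma elim_algebra (K : comNzRingType) (A C H K0 p1 p2 p3 p4 d X Y w D N W : K) :
  p1 * w = A * d + 6 * X * Y ->
  3 * d * p2 * w = 3 * p1 * X ^+ 2 + 2 * C * d * X + H * d ^+ 2 - 3 * d * Y ^+ 2 ->
  d ^+ 2 * p3 * w = 2 * p1 * w * Y * d
    - (4 * p1 * X ^+ 3 + 3 * C * d * X ^+ 2 + 2 * H * d ^+ 2 * X + K0 * d ^+ 3) ->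
  12 * d ^+ 3 * p4 * w = 72 * p1 * X ^+ 4 + 60 * C * d * X ^+ 3
    + 48 * H * d ^+ 2 * X ^+ 2 + 36 * K0 * d ^+ 3 * X
    + 2 * A ^+ 2 * d ^+ 3 - A * p1 * w * d ^+ 2
    + 6 * C * Y * w * d ^+ 2 - 36 * p1 * X * Y * w * d ->
  D = 2 * p1 * A * d ^+ 2 - 6 * p3 * d ^+ 2 * X - 72 * p2 * d * X ^+ 2 ->
  N = 8 * p1 ^+ 2 * X ^+ 3 + 5 * p1 * C * d * X ^+ 2
      + (2 * p1 * H - 12 * p2 * A) * d ^+ 2 * X - (p3 * A + p1 * K0) * d ^+ 3 ->
  W = A * d * D - 6 * X * N ->
  [/\ N = - (Y * D),
     (3 * p1 ^+ 2 * X ^+ 2 + 2 * p1 * C * d * X + (p1 * H - 3 * p2 * A) * d ^+ 2) * (D * D)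
       - 3 * p1 * d * (N * N) + 18 * p2 * d * X * (N * D) = 0 &
     (72 * p1 ^+ 2 * X ^+ 4 + 60 * p1 * C * d * X ^+ 3 + 48 * p1 * H * d ^+ 2 * X ^+ 2
       + 36 * p1 * K0 * d ^+ 3 * X + 2 * p1 * A ^+ 2 * d ^+ 3) * (D * D)
     - A * p1 * d ^+ 2 * (D * W)
     + 6 * (W * (6 * p1 * d * X * N - C * d ^+ 2 * N - 2 * p4 * d ^+ 3 * D)) = 0].
Proof.
move=> I1 I2 I3 I4.
have conic : p1 * (3 * p1 * X ^+ 2 + 2 * C * d * X + H * d ^+ 2 - 3 * d * Y ^+ 2)
             - 3 * d * p2 * (A * d + 6 * X * Y) = 0.
  by rewrite -I1 -I2; ring.
have cubic : (2 * p1 * Y * d - d ^+ 2 * p3) * (A * d + 6 * X * Y)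
     - p1 * (4 * p1 * X ^+ 3 + 3 * C * d * X ^+ 2 + 2 * H * d ^+ 2 * X + K0 * d ^+ 3) = 0.
  rewrite -I1 mulrBl [d ^+ 2 * p3 * _]mulrCA I3; ring.
have quartic : p1 * (72 * p1 * X ^+ 4 + 60 * C * d * X ^+ 3
       + 48 * H * d ^+ 2 * X ^+ 2 + 36 * K0 * d ^+ 3 * X + 2 * A ^+ 2 * d ^+ 3)
     + (6 * C * Y * d ^+ 2 - 36 * p1 * X * Y * d
        - A * p1 * d ^+ 2 - 12 * d ^+ 3 * p4) * (A * d + 6 * X * Y) = 0.
  rewrite -I1; move: I4; set rhs := (X in _ = X -> _) => I4.
  transitivity (p1 * (rhs - 12 * d ^+ 3 * p4 * w)); first by rewrite /rhs; ring.
  by rewrite I4 subrr mulr0.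
move=> DE NE ->; have ND : N = - (Y * D).
  apply/eqP; rewrite -subr_eq0 opprK -(addr0 0) -[X in _ == X + _]cubic.
  by rewrite -[X in _ == _ + X](mulr0 (4 * X)) -conic DE NE; apply/eqP; ring.
rewrite ND; split=> //.
  by rewrite -[RHS](mulr0 (D ^+ 2)) -[X in _ = _ * X]conic; ring.
by rewrite -[RHS](mulr0 (D ^+ 2)) -[X in _ = _ * X]quartic; ring.
Qed.

Lemma elim_roots (K : numFieldType) (f : flex_form K) :
  f130 f != 0 -> f301 f != 0 -> normal f ->
  let X := elimX f in let Y := f130 f * f202 f in
  [/\ (elimN f).[X] = - (Y * (elimD f).[X]), (elimG1 f).[X] = 0 & (elimG2 f).[X] = 0].
Proof.
move=> a0 l0 nf X Y.
have DE : (elimD f).[X] = 2 * s_coef f 0 3 * s_coef f 2 0 * (f130 f * f301 f) ^+ 2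
  - 6 * s_coef f 1 3 * (f130 f * f301 f) ^+ 2 * X
  - 72 * s_coef f 0 4 * (f130 f * f301 f) * X ^+ 2.
  by rewrite /elimD !(hornerXn, hornerD, hornerN, hornerM, hornerC, hornerX).
have NE : (elimN f).[X] = 8 * s_coef f 0 3 ^+ 2 * X ^+ 3
  + 5 * s_coef f 0 3 * s_coef f 1 2 * (f130 f * f301 f) * X ^+ 2
  + (2 * s_coef f 0 3 * s_coef f 2 1 - 12 * s_coef f 0 4 * s_coef f 2 0)
    * (f130 f * f301 f) ^+ 2 * X
  - (s_coef f 1 3 * s_coef f 2 0 + s_coef f 0 3 * s_coef f 3 0)
    * (f130 f * f301 f) ^+ 3.
  by rewrite /elimN !(hornerXn, hornerD, hornerN, hornerM, hornerC, hornerX).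
have WE : (elimW f).[X] = s_coef f 2 0 * (f130 f * f301 f) * (elimD f).[X]
                          - 6 * X * (elimN f).[X].
  by rewrite /elimW !(hornerD, hornerN, hornerM, hornerC, hornerX).
have [I1 I2 I3 I4] := elim_identities a0 l0 nf.
have [ND G1 G2] := elim_algebra I1 I2 I3 I4 DE NE WE; split=> //.
  rewrite /elimG1; move: (elimD f) (elimN f) G1 {G2 ND DE NE WE} => D N G1.
  by rewrite !(hornerXn, hornerD, hornerN, hornerM, hornerC, hornerX).
rewrite /elimG2; move: (elimD f) (elimN f) (elimW f) G2 {G1 ND DE NE WE} => D N W G2.
by rewrite !(hornerXn, hornerD, hornerN, hornerM, hornerC, hornerX).
Qed.

(** * A general quartic with a flex is determined by S *)

Section Recover.
Variable K : numFieldType.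
Implicit Types f g : flex_form K.

Definition opp_flex f := map_flex -%R f.

Lemma s_coef_opp f i j : s_coef (opp_flex f) i j = s_coef f i j.
Proof.
case: f => a b l m s r n q c h k e.
by case: i j => [|[|[|[|[|i]]]]] [|[|[|[|[|j]]]]] //=; ring.
Qed.

(** Each remaining coefficient occurs linearly, with factor f130 or f301, in some
    coefficient of S. *)
Lemma normal_coef_eq f1 f2 : (forall i j, s_coef f2 i j = s_coef f1 i j) ->
  f130 f1 != 0 -> f301 f1 != 0 -> normal f1 ->
  f130 f2 = f130 f1 -> elimX f2 = elimX f1 -> f130 f2 * f202 f2 = f130 f1 * f202 f1 ->
  f2 = f1.
Proof.
rewrite /normal /elimX.
case: f1 f2 => a b l m s r n q c h k e [a' b' l' m' s' r' n' q' c' h' k' e'] S a0 l0 [_ _ _] /=.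
move=> aE; subst a' => /(mulfI a0) mE; subst m' => /(mulfI a0) nE; subst n'.
have cancel (t x y p p' : K) : p = p' -> t != 0 -> t * (x - y) = p - p' -> x = y.
  move=> -> t0; rewrite subrr => /eqP.
  by rewrite mulf_eq0 (negPf t0) /= subr_eq0 => /eqP.
have nz (t : nat) (x : K) : x != 0 -> - t.+1%:R * x != 0.
  by move=> x0; rewrite mulf_neq0 // oppr_eq0 pnatr_eq0.
have ? : l' = l by apply: (cancel _ _ _ _ _ (S 0 1)%N (nz 3 _ a0)) => /=; ring.
subst l'.
have ? : b' = b.
  by apply: (cancel _ _ _ _ _ (esym (S 1 0)%N) (nz 3 _ l0)) => /=; ring.
subst b'.
have ? : s' = s by apply: (cancel _ _ _ _ _ (S 0 2)%N (nz 11 _ l0)) => /=; ring.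
subst s'.
have ? : r' = r.
  by apply: (cancel _ _ _ _ _ (esym (S 1 1)%N) (nz 11 _ l0)) => /=; ring.
subst r'.
have ? : q' = q by apply: (cancel _ _ _ _ _ (S 2 0)%N (nz 11 _ a0)) => /=; ring.
subst q'.
have ? : c' = c.
  by apply: (cancel _ _ _ _ _ (esym (S 1 2)%N) (nz 11 _ l0)) => /=; ring.
subst c'.
have ? : h' = h by apply: (cancel _ _ _ _ _ (S 2 1)%N (nz 11 _ a0)) => /=; ring.
subst h'.
have ? : k' = k by apply: (cancel _ _ _ _ _ (S 3 0)%N (nz 3 _ a0)) => /=; ring.
subst k'.
have ? : e' = e by apply: (cancel _ _ _ _ _ (S 3 1)%N (nz 3 _ a0)) => /=; ring.
by subst e'.
Qed.

Lemma shifted_root f (G : {poly K}) x : G.[elimX f] = 0 -> G.[x] = 0 -> x != elimX f ->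
  (shifted f G).[x - elimX f] = 0.
Proof.
move=> G0 Gx nx; have := shiftedE f G (x - elimX f).
rewrite [elimX f + _]addrC subrK Gx G0 add0r => /esym/eqP.
by rewrite mulf_eq0 subr_eq0 (negPf nx) => /eqP.
Qed.

(** X is the same for f1 and f2 because the two polynomials G1 and G2 depend on S
    alone and have no common root besides that of f1.  Then Y follows from the
    linear equation, and w = f130^2 from the first identity; the sign of f130
    remains. *)
Lemma normal_unique f1 f2 : (forall i j, s_coef f2 i j = s_coef f1 i j) ->
  normal f1 -> s_coef f1 0 1 != 0 -> s_coef f1 0 3 != 0 ->
  (elimD f1).[elimX f1] != 0 ->
  leadres 5 7 (shifted f1 (elimG1 f1)) (shifted f1 (elimG2 f1)) != 0 ->
  f2 = f1 \/ f2 = opp_flex f1.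
Proof.
move=> S nf1 d0 p10 D0 cop.
have nf2 : normal f2 by case: nf1 => *; split; rewrite S.
have S01 f : s_coef f 0 1 = - 4 * (f130 f * f301 f) by case: f => * /=; ring.
have nz4 : - 4 != 0 :> K by rewrite oppr_eq0 pnatr_eq0.
have dE : f130 f2 * f301 f2 = f130 f1 * f301 f1.
  by apply: (mulfI nz4); rewrite -!S01 S.
have /andP[a1 l1] : (f130 f1 != 0) && (f301 f1 != 0).
  by rewrite -negb_or -mulf_eq0; apply: contraNneq d0 => d0; rewrite S01 d0 mulr0.
have /andP[a2 l2] : (f130 f2 != 0) && (f301 f2 != 0).
  by rewrite -negb_or -mulf_eq0 dE mulf_neq0.
have DE : elimD f2 = elimD f1 by rewrite /elimD !S dE.
have NE : elimN f2 = elimN f1 by rewrite /elimN !S dE.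
have WE : elimW f2 = elimW f1 by rewrite /elimW !S dE DE NE.
have G1E : elimG1 f2 = elimG1 f1 by rewrite /elimG1 !S dE DE NE.
have G2E : elimG2 f2 = elimG2 f1 by rewrite /elimG2 !S dE WE DE NE.
have [N1 G11 G12] := elim_roots a1 l1 nf1.
have [N2 G21 G22] := elim_roots a2 l2 nf2.
rewrite {}DE {}NE in N2; rewrite {}G1E in G21; rewrite {}G2E in G22.
have XE : elimX f2 = elimX f1.
  apply/eqP/negPn/negP => nX.
  have r1 := shifted_root G11 G21 nX; have r2 := shifted_root G12 G22 nX.
  have := leadres_coprime cop.
  have [s1 _] := leadres_size (size_shifted f1 (size_elimG1 f1))
                   (size_shifted f1 (size_elimG2 f1)) cop.
  set g := gcdp _ _; have g0 : g != 0 by rewrite gcdp_eq0 -size_poly_eq0 s1.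
  have rg : all (root g) [:: elimX f2 - elimX f1] by rewrite /= root_gcd !rootE r1 r2 eqxx.
  by have := max_poly_roots g0 rg isT; rewrite ltnNge => /negPf->.
have YE : f130 f2 * f202 f2 = f130 f1 * f202 f1.
  by apply: (mulIf D0); apply: oppr_inj; rewrite -N1 -XE -N2.
have [I1 _ _ _] := elim_identities a1 l1 nf1; have [I2 _ _ _] := elim_identities a2 l2 nf2.
have : f130 f2 ^+ 2 == f130 f1 ^+ 2.
  by apply/eqP/(mulfI p10); rewrite I1 -[in LHS]S I2 !S dE XE YE.
rewrite eqf_sqr => /orP[] /eqP aE; [left|right].
  exact: normal_coef_eq.
apply: normal_coef_eq; rewrite ?s_coef_opp //.
- by move=> i j; rewrite S s_coef_opp.
- by move: a1; case: (f1) => * /=; rewrite oppr_eq0.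
- by move: l1; case: (f1) => * /=; rewrite oppr_eq0.
- by case: nf1 => *; split; rewrite s_coef_opp.
- by rewrite aE; case: (f1).
- by rewrite XE; case: (f1) => * /=; rewrite /elimX /= mulrNN.
by rewrite YE; case: (f1) => * /=; rewrite mulrNN.
Qed.

End Recover.

(** The third and fourth factors make the equations for w and Y nondegenerate, the
    last one says that G1 and G2 have only one common root. *)
Definition generic_recovery (R : idomainType) (f : flex_form R) : R :=
  let g := normalize f in
  s_coef f 0 1 * s_coef g 0 1 * s_coef g 0 3 * (elimD g).[elimX g]
  * leadres 5 7 (shifted g (elimG1 g)) (shifted g (elimG2 g)).

Lemma recover_from_S (K : numFieldType) (f1 f2 : flex_form K) :
  generic_recovery f1 != 0 -> (forall i j, s_coef f2 i j = s_coef f1 i j) ->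
  f2 = f1 \/ f2 = opp_flex f1.
Proof.
rewrite /generic_recovery mulf_eq0 negb_or => /andP[+ cop] S.
rewrite !mulf_eq0 !negb_or => /andP[/andP[/andP[d0 d1] p10] D0].
have [x [y [z [n1 n2]]]] : exists x y z,
    normalize f1 = move_flex ((3 * s_coef f1 0 1) ^+ 2) x y z f1 /\
    normalize f2 = move_flex ((3 * s_coef f1 0 1) ^+ 2) x y z f2.
  by rewrite /normalize !S; do 3!eexists.
have nz : (3 * s_coef f1 0 1) ^+ 2 != 0 by rewrite expf_neq0 // mulf_neq0 ?pnatr_eq0.
have Sn i j : s_coef (normalize f2) i j = s_coef (normalize f1) i j.
  rewrite n1 n2 !s_coef_move.
  by case: i j => [|[|[|[|[|i]]]]] [|[|[|[|[|j]]]]] //=; rewrite !S.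
have [] := normal_unique Sn (s_coef_normalize f1) d1 p10 D0 cop; rewrite n1 n2.
  by move/(move_flex_inj nz) => ->; left.
move=> E; right; apply: (move_flex_inj (d := (3 * s_coef f1 0 1) ^+ 2) (x := x) (y := y) (z := z) nz).
rewrite E; case: (f1) => a b l m s r n q c h k e /=; congr FlexForm; ring.
Qed.

(** * The genericity conditions under ring morphisms *)

Definition flex_R (R : comNzRingType) (f : flex_form R) : {poly R} :=
  leadres 4 6 (flex_S f) (flex_T f).
Definition S_at0 (R : nzRingType) (c : nat -> nat -> R) : {poly R} := \poly_(j < 5) c 0%N j.
(** The first factor says that the resultant of S and T has 24 distinct roots, the
    second one that S meets the line u = 0 in four distinct points. *)
Definition generic_flexes (R : idomainType) (f : flex_form R) : R :=
  leadres 24 23 (flex_R f) (flex_R f)^`()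
  * leadres 4 3 (S_at0 (s_coef f)) (S_at0 (s_coef f))^`().

Lemma size_flex_R (R : idomainType) (f : flex_form R) : (size (flex_R f) <= 25)%N.
Proof.
rewrite /flex_R /leadres /flex_S /flex_T !coef_bipoly_lead.
have [->|s0] := eqVneq (s_coef f 0 4) 0; first by rewrite !mul0r size_poly0.
have [->|t0] := eqVneq (t_coef f 0 6) 0; first by rewrite mulr0 !mul0r size_poly0.
rewrite -polyCM mul_polyC; have [sz _] := resultant_bipoly s0 t0.
by apply: leq_trans (size_scale_leq _ _) sz.
Qed.

Lemma size_deriv_le (R : idomainType) (p : {poly R}) n :
  (size p <= n.+1)%N -> (size p^`() <= n)%N.
Proof.
move=> sp; have [->|p0] := eqVneq p 0; first by rewrite deriv0 size_poly0.
by rewrite -ltnS (leq_trans (lt_size_deriv p0)).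
Qed.

Section Natural.
Variables (R R' : idomainType) (h : {rmorphism R -> R'}).
Implicit Types f : flex_form R.

Local Definition morphE := (@rmorph_nat _ _ h, @rmorphD _ _ h, @rmorphB _ _ h, @rmorphN _ _ h,
  @rmorphM _ _ h, @rmorphXn _ _ h, @rmorph0 _ _ h).

Lemma map_s_coef f i j : s_coef (map_flex h f) i j = h (s_coef f i j).
Proof.
case: f => a b l m s r n q c h1 k e.
case: i j => [|[|[|[|[|i]]]]] [|[|[|[|[|j]]]]] /=;
  by rewrite ?rmorph0 // !morphE.
Qed.

Lemma map_t_coef f i j : t_coef (map_flex h f) i j = h (t_coef f i j).
Proof.
case: f => a b l m s r n q c h1 k e.
case: i j => [|[|[|[|[|[|[|i]]]]]]] [|[|[|[|[|[|[|j]]]]]]] /=;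
  by rewrite ?rmorph0 // !morphE.
Qed.

Lemma map_flex_R f : map_poly h (flex_R f) = flex_R (map_flex h f).
Proof.
rewrite /flex_R (map_leadres (map_poly h)); try exact: size_poly.
rewrite !map_bipoly; congr leadres; apply/polyP => j; rewrite !coef_bipoly;
  by case: ifP => // _; apply/polyP => i; rewrite !coef_poly ?map_s_coef ?map_t_coef.
Qed.

Lemma map_generic_flexes f : h (generic_flexes f) = generic_flexes (map_flex h f).
Proof.
rewrite rmorphM !(map_leadres h) ?size_poly ?size_deriv_le ?size_poly ?size_flex_R //.
rewrite -!deriv_map map_flex_R; congr (_ * leadres _ _ _ _^`());
  by apply/polyP => j; rewrite coef_map /= !coef_poly map_s_coef; case: ifP; rewrite ?rmorph0.
Qed.

Lemma map_move_flex d x y z f :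
  map_flex h (move_flex d x y z f) = move_flex (h d) (h x) (h y) (h z) (map_flex h f).
Proof.
case: f => a b l m s r n q c h1 k e /=.
by congr FlexForm; rewrite !morphE.
Qed.

Lemma map_normalize f : map_flex h (normalize f) = normalize (map_flex h f).
Proof. by rewrite /normalize map_move_flex !map_s_coef !morphE. Qed.

Local Definition polyE := (@rmorphD _ _ (map_poly h), @rmorphB _ _ (map_poly h),
  @rmorphN _ _ (map_poly h), @rmorphM _ _ (map_poly h)).

Lemma map_flex_d f : f130 (map_flex h f) * f301 (map_flex h f) = h (f130 f * f301 f).
Proof. by case: f => * /=; rewrite rmorphM. Qed.

Lemma map_elimD f : map_poly h (elimD f) = elimD (map_flex h f).
Proof. by rewrite /elimD map_flex_d !map_s_coef !polyE /= !map_polyX !map_polyC /= !morphE. Qed.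

Lemma map_elimN f : map_poly h (elimN f) = elimN (map_flex h f).
Proof. by rewrite /elimN map_flex_d !map_s_coef !polyE /= ?map_polyX !map_polyC /= !morphE. Qed.

Lemma map_elimW f : map_poly h (elimW f) = elimW (map_flex h f).
Proof.
by rewrite /elimW map_flex_d !map_s_coef -map_elimN -map_elimD !polyE /= ?map_polyX !map_polyC /= !morphE.
Qed.

Lemma map_elimG1 f : map_poly h (elimG1 f) = elimG1 (map_flex h f).
Proof.
rewrite /elimG1 map_flex_d !map_s_coef -map_elimN -map_elimD.
by move: (elimD f) (elimN f) => D N; rewrite !polyE /= ?map_polyX !map_polyC /= !morphE.
Qed.

Lemma map_elimG2 f : map_poly h (elimG2 f) = elimG2 (map_flex h f).
Proof.
rewrite /elimG2 map_flex_d !map_s_coef -map_elimW -map_elimN -map_elimD.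
by move: (elimD f) (elimN f) (elimW f) => D N W; rewrite !polyE /= ?map_polyX !map_polyC /= !morphE.
Qed.

Lemma map_elimX f : elimX (map_flex h f) = h (elimX f).
Proof. by case: f => * /=; rewrite /elimX rmorphM. Qed.

Lemma map_shifted f G : map_poly h (shifted f G) = shifted (map_flex h f) (map_poly h G).
Proof.
apply/polyP => i; rewrite coef_map !coef_drop_poly map_elimX.
by rewrite -(map_polyC h) -(map_polyX h) -rmorphD -map_comp_poly coef_map.
Qed.

Lemma map_generic_recovery f :
  h (generic_recovery f) = generic_recovery (map_flex h f).
Proof.
rewrite /generic_recovery -map_normalize; move: (normalize f) => g.
rewrite rmorphM (map_leadres h) ?size_shifted ?size_elimG1 ?size_elimG2 //.
rewrite !map_shifted map_elimG1 map_elimG2; congr (_ * _).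
by rewrite !rmorphM -!map_s_coef -horner_map map_elimD map_elimX.
Qed.

End Natural.

(** * A sample quartic modulo 29 *)

Section ListPoly.
Variable F : fieldType.
Implicit Types s t : seq F.

(** Polynomials over a finite field as coefficient lists, on which everything can
    be evaluated by the kernel. *)
Fixpoint addL s t := match s, t with
  | [::], _ => t
  | _, [::] => s
  | c :: s', e :: t' => c + e :: addL s' t' end.
Definition scaleL c s := [seq c * x | x <- s].
Definition mulL s t := foldr (fun c r => addL (scaleL c t) (0 :: r)) [::] s.
Definition hornerL (ss : seq (seq F)) t := foldr (fun s r => addL s (mulL r t)) [::] ss.
Definition derivL s := [seq s`_i.+1 *+ i.+1 | i <- iota 0 (size s).-1].
Definition bipolyL d (c : nat -> nat -> F) :=
  mkseq (fun j => mkseq (fun i => c i j) (d - j).+1) d.+1.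

(** Long division and the extended Euclidean algorithm.  Their output is not
    trusted but checked: [dividesL] and [coprimeL] test the identities that it has
    to satisfy. *)
Fixpoint quo_loop n s t :=
  if n isn't n'.+1 then [::] else
  if (size s < size t)%N then [::] else
  let c := head 0 s / head 0 t in
  c :: quo_loop n' (behead (addL s (scaleL (- c) t))) t.
Definition quoL s t := rev (quo_loop (size s) (rev s) (rev t)).
Definition strip s := foldr (fun c r => if (c == 0) && nilp r then [::] else c :: r) [::] s.
Fixpoint bezout_loop n r0 u0 v0 r1 u1 v1 :=
  if n isn't n'.+1 then (u1, v1) else
  if (size r1 <= 1)%N then (scaleL (r1`_0)^-1 u1, scaleL (r1`_0)^-1 v1) else
  let q := scaleL (-1) (quoL r0 r1) in
  bezout_loop n' r1 u1 v1 (strip (addL r0 (mulL q r1))) (addL u0 (mulL q u1))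
    (addL v0 (mulL q v1)).
Definition bezoutL s t := bezout_loop (size s + size t) s [:: 1] [::] t [::] [:: 1].

Definition is_one s := strip s == [:: 1].
Definition coprimeL s t :=
  let: (u, v) := bezoutL s t in is_one (addL (mulL u s) (mulL v t)).

Lemma Poly_cons c s : Poly (c :: s) = Poly s * 'X + c%:P.
Proof. by rewrite /= cons_poly_def. Qed.

Lemma Poly_addL s t : Poly (addL s t) = Poly s + Poly t.
Proof.
elim: s t => [|c s IHs] [|e t]; rewrite ?addr0 ?add0r //= ?cons_poly_def.
by rewrite IHs polyCD; ring.
Qed.

Lemma Poly_scaleL c s : Poly (scaleL c s) = c%:P * Poly s.
Proof.
elim: s => [|e s IHs] /=; first by rewrite mulr0.
by rewrite !cons_poly_def IHs polyCM; ring.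
Qed.

Lemma Poly_mulL s t : Poly (mulL s t) = Poly s * Poly t.
Proof.
elim: s => [|c s IHs] /=; first by rewrite mul0r.
by rewrite cons_poly_def Poly_addL Poly_scaleL Poly_cons IHs; ring.
Qed.

Lemma Poly_hornerL ss t : Poly (hornerL ss t) = (Poly (map Poly ss)).[Poly t].
Proof.
elim: ss => [|s ss IHs] /=; first by rewrite horner0.
by rewrite Poly_addL Poly_mulL IHs horner_cons addrC.
Qed.

Lemma Poly_derivL s : Poly (derivL s) = (Poly s)^`().
Proof.
apply/polyP => i; rewrite coef_deriv !coef_Poly.
have [lti|lei] := ltnP i (size s).-1.
  by rewrite (nth_map 0%N) ?size_iota // nth_iota.
rewrite [LHS]nth_default ?size_map ?size_iota // [s`_ _]nth_default ?mul0rn //.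
by rewrite -ltnS; case: (size s) lei.
Qed.

Lemma Poly_mkseq (G : nzRingType) n (E : nat -> G) : \poly_(i < n) E i = Poly (mkseq E n).
Proof.
apply/polyP => i; rewrite coef_poly coef_Poly.
by case: ltnP => ni; [rewrite nth_mkseq|rewrite nth_default ?size_mkseq].
Qed.

Lemma Poly_bipolyL d c : bipoly d c = Poly (map Poly (bipolyL d c)).
Proof.
rewrite /bipoly Poly_mkseq; congr Poly; rewrite /bipolyL /mkseq -map_comp.
by apply: eq_map => j /=; rewrite Poly_mkseq.
Qed.

Lemma Poly_is_one s : is_one s -> Poly s = 1.
Proof.
move/eqP => s1; suff <- : Poly (strip s) = Poly s by rewrite s1 /= cons_poly_def mul0r add0r.
elim: s {s1} => //= c s <-; case: ifP => //= /andP[/eqP -> /nilP ->].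
by rewrite cons_poly_def mul0r add0r.
Qed.

Lemma coprimeLP s t : coprimeL s t -> coprimep (Poly s) (Poly t).
Proof.
rewrite /coprimeL; case: (bezoutL s t) => u v /Poly_is_one one.
apply/Bezout_coprimepP; exists (Poly u, Poly v) => /=.
by rewrite -!Poly_mulL -Poly_addL one eqpxx.
Qed.

Lemma resultant_neq0 (p q : {poly F}) : coprimep p q -> resultant p q != 0.
Proof. by rewrite resultant_eq0 coprimep_def => /eqP ->. Qed.

Lemma leadres_Poly m n s t : s`_m != 0 -> t`_n != 0 -> coprimeL s t ->
  leadres m n (Poly s) (Poly t) != 0.
Proof.
move=> sm tn /coprimeLP/resultant_neq0 st.
by rewrite /leadres !mulf_neq0 // coef_Poly.
Qed.

Definition dividesL t s :=
  nilp (strip (addL s (scaleL (-1) (mulL (quoL s t) t)))).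
Definition sumL s := foldr +%R 0 s.

Lemma Poly_strip s : Poly (strip s) = Poly s.
Proof.
elim: s => //= c s <-; case: ifP => //= /andP[/eqP -> /nilP ->].
by rewrite cons_poly_def mul0r add0r.
Qed.

Lemma dividesLP t s : dividesL t s -> Poly t %| Poly s.
Proof.
move/nilP/(congr1 (@Poly F)); rewrite Poly_strip Poly_addL Poly_scaleL Poly_mulL /=.
by rewrite polyCN mulN1r => /eqP; rewrite subr_eq0 => /eqP ->; apply: dvdp_mulIr.
Qed.

Lemma horner1_map ss : map_poly (horner_eval 1) (Poly (map Poly ss)) = Poly (map sumL ss).
Proof.
rewrite map_Poly_id0 /horner_eval ?horner0 // -map_comp; congr Poly; apply: eq_map => s /=.
elim: s => [|c s IHs] /=; first by rewrite horner0.
by rewrite horner_cons mulr1 IHs addrC.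
Qed.

Definition elimDL (f : flex_form F) := let S := s_coef f in let d := f130 f * f301 f in
  [:: 2 * S 0%N 3%N * S 2%N 0%N * d ^+ 2; - (6 * S 1%N 3%N * d ^+ 2); - (72 * S 0%N 4%N * d)].
Definition elimNL (f : flex_form F) := let S := s_coef f in let d := f130 f * f301 f in
  [:: - ((S 1%N 3%N * S 2%N 0%N + S 0%N 3%N * S 3%N 0%N) * d ^+ 3);
      (2 * S 0%N 3%N * S 2%N 1%N - 12 * S 0%N 4%N * S 2%N 0%N) * d ^+ 2;
      5 * S 0%N 3%N * S 1%N 2%N * d; 8 * S 0%N 3%N ^+ 2].
Definition elimWL (f : flex_form F) :=
  addL (mulL [:: s_coef f 2 0 * (f130 f * f301 f)] (elimDL f))
       (mulL [:: 0; - 6] (elimNL f)).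
Definition elimG1L (f : flex_form F) := let S := s_coef f in let d := f130 f * f301 f in
  addL (mulL [:: (S 0%N 3%N * S 2%N 1%N - 3 * S 0%N 4%N * S 2%N 0%N) * d ^+ 2;
                 2 * S 0%N 3%N * S 1%N 2%N * d; 3 * S 0%N 3%N ^+ 2] (mulL (elimDL f) (elimDL f)))
  (addL (mulL [:: - (3 * S 0%N 3%N * d)] (mulL (elimNL f) (elimNL f)))
        (mulL [:: 0; 18 * S 0%N 4%N * d] (mulL (elimNL f) (elimDL f)))).
Definition elimG2L (f : flex_form F) := let S := s_coef f in let d := f130 f * f301 f in
  addL (mulL [:: 2 * S 0%N 3%N * S 2%N 0%N ^+ 2 * d ^+ 3; 36 * S 0%N 3%N * S 3%N 0%N * d ^+ 3;
                 48 * S 0%N 3%N * S 2%N 1%N * d ^+ 2; 60 * S 0%N 3%N * S 1%N 2%N * d;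
                 72 * S 0%N 3%N ^+ 2] (mulL (elimDL f) (elimDL f)))
  (addL (mulL [:: - (S 2%N 0%N * S 0%N 3%N * d ^+ 2)] (mulL (elimDL f) (elimWL f)))
        (mulL [:: 6] (mulL (elimWL f)
           (addL (mulL [:: - (S 1%N 2%N * d ^+ 2); 6 * S 0%N 3%N * d] (elimNL f))
                 (mulL [:: - (2 * S 2%N 2%N * d ^+ 3)] (elimDL f)))))).

Lemma Poly_elimDL f : elimD f = Poly (elimDL f).
Proof.
rewrite /elimD /elimDL; move: (s_coef f) (f130 f * f301 f) => S d.
by rewrite !Poly_cons /=; ring.
Qed.
Lemma Poly_elimNL f : elimN f = Poly (elimNL f).
Proof.
rewrite /elimN /elimNL; move: (s_coef f) (f130 f * f301 f) => S d.
by rewrite !Poly_cons /=; ring.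
Qed.
Lemma Poly_elimWL f : elimW f = Poly (elimWL f).
Proof.
rewrite /elimW Poly_elimDL Poly_elimNL /elimWL (Poly_addL (mulL _ _) (mulL _ _)).
rewrite !Poly_mulL !Poly_cons /=; move: (Poly (elimDL f)) (Poly (elimNL f)) => D N.
by move: (s_coef f) (f130 f * f301 f) => S d; ring.
Qed.

Lemma Poly_elimG1L f : elimG1 f = Poly (elimG1L f).
Proof.
rewrite /elimG1 Poly_elimDL Poly_elimNL /elimG1L; cbv zeta.
rewrite (Poly_addL (mulL _ _) (addL _ _)) (Poly_addL (mulL _ _) (mulL _ _)) !Poly_mulL.
rewrite !Poly_cons /=; move: (Poly (elimDL f)) (Poly (elimNL f)) => D N.
by move: (s_coef f) (f130 f * f301 f) => S d; ring.
Qed.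

Lemma Poly_elimG2L f : elimG2 f = Poly (elimG2L f).
Proof.
rewrite /elimG2 Poly_elimDL Poly_elimNL Poly_elimWL /elimG2L; cbv zeta.
rewrite (Poly_addL (mulL _ _) (addL _ _)) (Poly_addL (mulL _ _) (mulL _ _)) !Poly_mulL.
rewrite (Poly_addL (mulL _ _) (mulL _ _)) !Poly_mulL !Poly_cons /=.
move: (Poly (elimDL f)) (Poly (elimNL f)) (Poly (elimWL f)) => D N W.
by move: (s_coef f) (f130 f * f301 f) => S d; ring.
Qed.

Lemma shifted_Poly f s : elimX f = 0 -> shifted f (Poly s) = Poly (behead s).
Proof.
move=> X0; rewrite /shifted X0 addr0 comp_polyXr.
by apply/polyP => i; rewrite coef_drop_poly !coef_Poly nth_behead addn1.
Qed.

End ListPoly.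

(** 4 x y^3 + 4 x^3 z + 12 x y z^2 + 6 y^2 z^2 + 4 x z^3 + z^4. *)
Definition sample : flex_form 'F_29 := FlexForm 1 0 1 0 0 0 0 1 1 1 0 1.
Definition seq29 (s : seq nat) : seq 'F_29 := [seq n%:R | n <- s].
(** The points of S = T = 0 for the sample are the points (u, v) with R(u) = 0 and
    v = V(u), where R is [sample_R] and V is [sample_v].  This makes R a divisor
    of the resultant of S and T without expanding a determinant. *)
Definition sample_R := seq29 [:: 0; 25; 15; 10; 22; 22; 10; 14; 13; 19; 28; 17; 1;
  23; 0; 22; 3; 27; 13; 14; 7; 3; 16; 27; 1]%N.
Definition sample_v := seq29 [:: 0; 7; 8; 5; 2; 17; 11; 4; 10; 20; 9; 5; 5; 9; 10;
  7; 25; 17; 13; 6; 10; 13; 1; 22]%N.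

Lemma sample_flexes : generic_flexes sample != 0.
Proof.
have s04 : s_coef sample 0 4 != 0 by vm_compute.
have t06 : t_coef sample 0 6 != 0 by vm_compute.
rewrite mulf_neq0 //; last first.
  by rewrite /S_at0 Poly_mkseq -Poly_derivL leadres_Poly //; vm_compute.
have szS := size_bipoly s04; have szT := size_bipoly t06.
set R := resultant (flex_S sample) (flex_T sample).
(* At u = 0 the resultant vanishes, at u = 1 it does not. *)
have R0 : R != 0.
  suff : R.[1] != 0 by apply: contraNneq => ->; rewrite horner0.
  have lS : horner_eval 1 (lead_coef (flex_S sample)) != 0.
    by rewrite lead_coefE szS coef_bipoly_lead horner_evalE hornerC.
  have lT : horner_eval 1 (lead_coef (flex_T sample)) != 0.
    by rewrite lead_coefE szT coef_bipoly_lead horner_evalE hornerC.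
  rewrite -[R.[1]]/(horner_eval 1 R) (@map_resultant _ _ (horner_eval 1) _ _ lS lT).
  rewrite /flex_S /flex_T !Poly_bipolyL !horner1_map.
  by apply/resultant_neq0/coprimeLP; vm_compute.
(* The resultant is a combination of S and T; set v = V(u) in it. *)
have dvdR : Poly sample_R %| R.
  have gS : (1 < size (flex_S sample))%N by rewrite szS.
  have gT : (1 < size (flex_T sample))%N by rewrite szT.
  have [uv _ /(congr1 (horner^~ (Poly sample_v)))] := resultant_in_ideal gS gT.
  rewrite hornerC -/R => ->; rewrite hornerD !hornerM.
  rewrite /flex_S /flex_T !Poly_bipolyL -!Poly_hornerL.
  by apply: dvdp_add; apply/dvdp_mull/dividesLP; vm_compute.
have szR : (size R <= 25)%N by have [] := resultant_bipoly s04 t06.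
have [k k0 RE] : exists2 k, k != 0 & flex_R sample = k *: Poly sample_R.
  have : Poly sample_R %= R.
    rewrite -(dvdp_size_eqp dvdR) eqn_leq (dvdp_leq R0 dvdR) andTb.
    apply: (leq_trans szR); rewrite ltnNge; apply/negP => /leq_sizeP/(_ 24 (leqnn _))/eqP.
    by rewrite coef_Poly; vm_compute.
  case/eqpP => -[c1 c2] /andP[].
  rewrite -[(c1, c2).1]/c1 -[(c1, c2).2]/c2 => c10 c20 cE.
  have cR : (c1 / c2) *: Poly sample_R = R by rewrite mulrC -scalerA cE scalerA mulVf ?scale1r.
  exists (s_coef sample 0 4 * t_coef sample 0 6 * (c1 / c2)).
    by rewrite mulf_neq0 ?mulf_neq0 ?invr_eq0.
  by rewrite /flex_R /leadres /flex_S /flex_T !coef_bipoly_lead -polyCM mul_polyC -/R -cR scalerA.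
rewrite RE derivZ /leadres !coefZ -Poly_derivL !coef_Poly.
have lead0 : sample_R`_24 != 0 by vm_compute.
have lead1 : (derivL sample_R)`_23 != 0 by vm_compute.
apply: (mulf_neq0 (mulf_neq0 (mulf_neq0 k0 lead0) (mulf_neq0 k0 lead1))).
apply: resultant_neq0; rewrite (coprimepZl _ _ k0) (coprimepZr _ _ k0).
by apply: coprimeLP; vm_compute.
Qed.

Lemma sample_recovery : generic_recovery sample != 0.
Proof.
have X0 : elimX (normalize sample) = 0 by apply/eqP; vm_compute.
have h1 : s_coef sample 0 1 != 0 by vm_compute.
have h2 : s_coef (normalize sample) 0 1 != 0 by vm_compute.
have h3 : s_coef (normalize sample) 0 3 != 0 by vm_compute.
have h4 : (elimDL (normalize sample))`_0 != 0 by vm_compute.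
have h5 : leadres 5 7 (Poly (behead (elimG1L (normalize sample))))
                      (Poly (behead (elimG2L (normalize sample)))) != 0.
  by apply: leadres_Poly; vm_compute.
rewrite /generic_recovery Poly_elimG1L Poly_elimG2L Poly_elimDL.
rewrite !(shifted_Poly _ X0) X0 horner_coef0 coef_Poly.
exact: (mulf_neq0 (mulf_neq0 (mulf_neq0 (mulf_neq0 h1 h2) h3) h4) h5).
Qed.

(** * Binary quartics with a triple root *)

Section BinaryQuartic.
Variable K : numFieldType.
Implicit Types b : nat -> K.

Definition bquart b (s t : K) := b 0%N * s ^+ 4 + 4 * b 1%N * s ^+ 3 * t
  + 6 * b 2%N * s ^+ 2 * t ^+ 2 + 4 * b 3%N * s * t ^+ 3 + b 4%N * t ^+ 4.

(** The binary quartic b in the basis (x, y), (x', y'), see [bquart_atE]. *)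
Definition bquart_at b (x y x' y' : K) (i : nat) : K :=
  match i with
  | 0 => bquart b x y
  | 1 => (b 0%N * x ^+ 3 + 3 * b 1%N * x ^+ 2 * y + 3 * b 2%N * x * y ^+ 2 + b 3%N * y ^+ 3) * x'
       + (b 1%N * x ^+ 3 + 3 * b 2%N * x ^+ 2 * y + 3 * b 3%N * x * y ^+ 2 + b 4%N * y ^+ 3) * y'
  | 2 => (b 0%N * x ^+ 2 + 2 * b 1%N * x * y + b 2%N * y ^+ 2) * x' ^+ 2
       + 2 * (b 1%N * x ^+ 2 + 2 * b 2%N * x * y + b 3%N * y ^+ 2) * x' * y'
       + (b 2%N * x ^+ 2 + 2 * b 3%N * x * y + b 4%N * y ^+ 2) * y' ^+ 2
  | 3 => (b 0%N * x' ^+ 3 + 3 * b 1%N * x' ^+ 2 * y' + 3 * b 2%N * x' * y' ^+ 2 + b 3%N * y' ^+ 3) * x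
       + (b 1%N * x' ^+ 3 + 3 * b 2%N * x' ^+ 2 * y' + 3 * b 3%N * x' * y' ^+ 2 + b 4%N * y' ^+ 3) * y
  | _ => bquart b x' y'
  end.

Lemma bquart_atE b x y x' y' s t :
  bquart (bquart_at b x y x' y') s t = bquart b (s * x + t * x') (s * y + t * y').
Proof. by rewrite /bquart /= /bquart; ring. Qed.

Lemma quartic_I_at b x y x' y' :
  quartic_I (bquart_at b x y x' y') = (x * y' - y * x') ^+ 4 * quartic_I b.
Proof. by rewrite /quartic_I /= /bquart; ring. Qed.

Lemma quartic_J_at b x y x' y' :
  quartic_J (bquart_at b x y x' y') = (x * y' - y * x') ^+ 6 * quartic_J b.
Proof. by rewrite /quartic_J /= /bquart; ring. Qed.

Lemma triple_root_invariants b x y x' y' : x * y' - y * x' != 0 ->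
  (forall i, (i < 3)%N -> bquart_at b x y x' y' i = 0) ->
  quartic_I b = 0 /\ quartic_J b = 0.
Proof.
move=> det0 c0; have dn n : (x * y' - y * x') ^+ n != 0 by rewrite expf_neq0.
split; [apply: (mulfI (dn 4%N))|apply: (mulfI (dn 6%N))].
  by rewrite -quartic_I_at mulr0 /quartic_I (c0 0%N) // (c0 1%N) // (c0 2) //; ring.
by rewrite -quartic_J_at mulr0 /quartic_J (c0 0%N) // (c0 1%N) // (c0 2) //; ring.
Qed.

(** If b0 is nonzero, complete the fourth power: b becomes b0 times
    s^4 + 6 C s^2 t^2 + 4 D s t^3 + E t^4, and I = J = 0 reads E = - 3 C^2,
    D^2 = - 4 C^3.  This is (s - r t)^3 (s + 3 r t) for r = - D / (2 C), so the
    triple root is rational and no equation has to be solved.  If b0 = 0, the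
    relations give b3 and b4 from b1 and b2. *)
Lemma invariants_triple_root b : quartic_I b = 0 -> quartic_J b = 0 ->
  exists x y m n, ((x != 0) || (y != 0)) /\
    forall s t, bquart b s t = (s * y - t * x) ^+ 3 * (m * s + n * t).
Proof.
rewrite /quartic_I /quartic_J /bquart.
move: (b 0%N) (b 1%N) (b 2%N) (b 3%N) (b 4%N) => b0 b1 b2 b3 b4 I0 J0.
have nz2 : 2 != 0 :> K by rewrite pnatr_eq0.
have [b00|b0nz] := eqVneq b0 0.
  rewrite {}b00 in I0 J0 *.
  have [b10|b1nz] := eqVneq b1 0.
    rewrite {}b10 in I0 J0 *; have b20 : b2 = 0.
      have : b2 ^+ 3 = 0 by rewrite -[LHS]opprK -[RHS]oppr0 -[in RHS]J0; ring.
      by move/eqP; rewrite expf_eq0 => /eqP.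
    by exists 1, 0, (- (4 * b3)), (- b4); rewrite oner_eq0; split => // s t; rewrite b20; ring.
  have b3E : b3 = 3 * b2 ^+ 2 / (4 * b1).
    have : 4 * b1 * b3 = 3 * b2 ^+ 2.
      by apply/eqP; rewrite -subr_eq0 -oppr_eq0 -[X in _ == X]I0; apply/eqP; ring.
    by move=> <-; field; rewrite b1nz.
  have b4E : b4 = b2 ^+ 3 / (2 * b1 ^+ 2).
    apply: (mulfI (expf_neq0 2 b1nz)).
    transitivity (2 * b1 * b2 * b3 - b2 ^+ 3); last by rewrite b3E; field; rewrite b1nz.
    by apply/eqP; rewrite -subr_eq0 -oppr_eq0 -[X in _ == X]J0; apply/eqP; ring.
  exists (- b2), (2 * b1), 0, ((2 * b1 ^+ 2)^-1).
  rewrite mulf_eq0 negb_or nz2 b1nz orbT; split=> // s t.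
  by rewrite b4E b3E; field; rewrite b1nz.
pose B := b1 / b0; pose C := b2 / b0 - B ^+ 2; pose D := b3 / b0 - B ^+ 3 - 3 * B * C.
pose E := b4 / b0 - B ^+ 4 - 6 * B ^+ 2 * C - 4 * B * D.
have b1E : b1 = b0 * B by rewrite /B; field.
have b2E : b2 = b0 * (B ^+ 2 + C) by rewrite /C; field.
have b3E : b3 = b0 * (B ^+ 3 + 3 * B * C + D) by rewrite /D; field.
have b4E : b4 = b0 * (B ^+ 4 + 6 * B ^+ 2 * C + 4 * B * D + E) by rewrite /E; field.
clearbody B C D E; rewrite {}b1E {}b2E {}b3E {}b4E in I0 J0 *.
have EE : E = - 3 * C ^+ 2.
  apply: (mulfI (expf_neq0 2 b0nz)); apply/eqP; rewrite -subr_eq0 -[X in _ == X]I0.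
  by apply/eqP; ring.
have DE : D ^+ 2 = - 4 * C ^+ 3.
  apply: (mulfI (expf_neq0 3 b0nz)); apply/eqP; rewrite -subr_eq0 -oppr_eq0 -[X in _ == X]J0.
  by apply/eqP; rewrite EE; ring.
have [C0|Cnz] := eqVneq C 0.
  have D0 : D = 0 by move/eqP: DE; rewrite C0 expr0n mulr0 expf_eq0 => /eqP.
  exists (- B), 1, b0, (b0 * B); rewrite oner_eq0 orbT; split=> // s t.
  by rewrite EE C0 D0; ring.
pose r := - D / (2 * C).
have Cr : C = - r ^+ 2.
  by rewrite /r; transitivity (- (D ^+ 2) / (4 * C ^+ 2)); [rewrite DE; field|field].
have Dr : D = 2 * r ^+ 3.
  transitivity (- 2 * C * r); first by rewrite /r; field.
  by rewrite Cr; ring.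
exists (r - B), 1, b0, (b0 * (B + 3 * r)); rewrite oner_eq0 orbT; split=> // s t.
by rewrite EE Dr Cr; ring.
Qed.

End BinaryQuartic.

(** * Ternary quartics in coordinates *)

Section Substitution.
Variable K : fieldType.
Implicit Types (F : {mpoly K[3]}) (A B : 'M[K]_3).

(** Substitution of the row vector of variables times A. *)
Definition lin A : 3.-tuple {mpoly K[3]} := [tuple \sum_(j < 3) A j i *: 'X_j | i < 3].

Lemma lin_meval F A v : (F \mPo lin A).@[v] = F.@[fun i => \sum_(j < 3) A j i * v j].
Proof.
rewrite comp_mpoly_meval; apply: meval_eq => i; rewrite tnth_mktuple raddf_sum /=.
by apply: eq_bigr => j _; rewrite mevalZ mevalXU.
Qed.

Lemma lin_homog F A d : F \is d.-homog -> (F \mPo lin A) \is d.-homog.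
Proof.
move=> /dhomogP hF; rewrite comp_mpolyEX big_seq; apply: rpred_sum => m /hF /= <-.
apply: rpredZ; rewrite comp_mpolyX mdegE.
elim: (index_enum _) => [|i s IHs]; first by rewrite !big_nil dhomog1.
rewrite !big_cons; apply: dhomogM => //.
suff : tnth (lin A) i \is 1.-homog by move/(dhomogMn (m i)); rewrite mul1n.
rewrite tnth_mktuple; apply: rpred_sum => j _; apply: rpredZ.
by rewrite dhomogX /= mdeg1.
Qed.

Lemma lin_comp F A B : A *m B = 1%:M -> (F \mPo lin B) \mPo lin A = F.
Proof.
move=> AB; rewrite [in RHS](mpolyE F) [F \mPo _]comp_mpolyEX raddf_sum /=.
apply: eq_bigr => m _; rewrite comp_mpolyZ; congr (_ *: _).
rewrite comp_mpolyX rmorph_prod [RHS]mpolyXE_id; apply: eq_bigr => i _.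
rewrite rmorphXn /=; congr (_ ^+ _); rewrite tnth_mktuple raddf_sum /=.
under eq_bigr => j _ do rewrite comp_mpolyZ comp_mpolyXU -tnth_nth tnth_mktuple scaler_sumr.
rewrite exchange_big /= (bigD1 i) //= [X in _ + X]big1 ?addr0 => [|k ki].
  under eq_bigr => j _ do rewrite scalerA mulrC.
  rewrite -scaler_suml; move/matrixP/(_ i i): AB; rewrite !mxE eqxx => ->.
  by rewrite scale1r.
under eq_bigr => j _ do rewrite scalerA mulrC.
rewrite -scaler_suml; move/matrixP/(_ k i): AB; rewrite !mxE (negPf ki) => ->.
by rewrite scale0r.
Qed.

End Substitution.

Definition mon (i j : nat) : 'X_{1..3} := [multinom [tuple i; j; (4 - i - j)%N]].

Definition exponents : seq (nat * nat) :=
  [:: (4, 0); (3, 1); (2, 2); (1, 3); (0, 4); (3, 0); (2, 1); (1, 2); (0, 3);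
      (2, 0); (1, 1); (0, 2); (1, 0); (0, 1); (0, 0)]%N.

Lemma exponents_le i j : (i, j) \in exponents -> (i + j <= 4)%N.
Proof. by move=> ij; apply: (allP (isT : all (fun e => e.1 + e.2 <= 4)%N exponents) _ ij). Qed.

Lemma monE i j : (mon i j 0 = i) * (mon i j 1 = j) * (mon i j ord_max = 4 - i - j)%N.
Proof. by rewrite /mon !multinomE !(tnth_nth 0%N) /=. Qed.

Lemma mdeg_mon i j : (i + j <= 4)%N -> mdeg (mon i j) = 4%N.
Proof.
move=> ij; rewrite mdegE !big_ord_recr big_ord0 /= /mon !multinomE !(tnth_nth 0%N) /=; lia.
Qed.

Lemma mon_exponents m : mdeg m = 4%N -> exists i j, (i, j) \in exponents /\ m = mon i j.
Proof.
rewrite mdegE !big_ord_recr big_ord0 /= add0n => mE.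
exists (m 0%R), (m 1%R); split.
  have : (m 0%R + m 1%R <= 4)%N.
    rewrite -mE; apply: leq_trans (leq_addr _ _).
    by rewrite leq_add //; apply/eq_leq; congr (m _); apply: val_inj.
  by move: (m 0%R) (m 1%R) => [|[|[|[|[|x]]]]] [|[|[|[|[|y]]]]].
apply/mnmP => i; rewrite /mon multinomE (tnth_nth 0%N).
case: i => -[|[|[|i]]] //= lti.
- by congr (m _); apply: val_inj.
- by congr (m _); apply: val_inj.
rewrite -mE; set x := m (widen_ord _ _); set y := m (widen_ord _ _); set z := m ord_max.
have -> : m 0%R = x by congr (m _); apply: val_inj.
have -> : m 1%R = y by congr (m _); apply: val_inj.
have -> : m (Ordinal lti) = z by congr (m _); apply: val_inj.
by lia.
Qed.

Section Homog.
Variable K : fieldType.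
Implicit Types (F : {mpoly K[3]}).

Lemma quartic_monomials_perm :
  perm_eq quartic_monomials [seq mon ij.1 ij.2 | ij <- exponents].
Proof.
apply: uniq_perm; first exact: uniq_basis.
  rewrite map_inj_uniq // => -[i j] [i' j'] /= E.
  by rewrite -(monE i j).1.1 -[j in LHS](monE i j).1.2 E !monE.
move=> m; rewrite -basis_cover; apply/eqP/mapP => [/mon_exponents|].
  by move=> [i [j [ij ->]]]; exists (i, j).
by move=> [[i j] /exponents_le ij ->]; rewrite mdeg_mon.
Qed.

Lemma homog_coefP F : F \is 4.-homog -> F = \sum_(m <- quartic_monomials) F@_m *: 'X_[m].
Proof.
move=> hF; rewrite {1}(mpolyE F).
rewrite [RHS](bigID (fun m => F@_m == 0)) /= [X in _ = X + _]big1 => [|m /eqP->]; last first.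
  by rewrite scale0r.
rewrite add0r -[RHS]big_filter; apply: perm_big; apply: uniq_perm.
- exact: msupp_uniq.
- by rewrite filter_uniq ?uniq_basis.
move=> m; rewrite mem_filter mcoeff_msupp /= -basis_cover.
apply/idP/andP => [Fm|[]//]; split=> //.
by apply: contraNT Fm => md; rewrite (dhomog_nemf_coeff hF).
Qed.

Lemma homog_meval F v : F \is 4.-homog ->
  F.@[v] = \sum_(ij <- exponents)
     F@_(mon ij.1 ij.2) * (v 0 ^+ ij.1 * v 1 ^+ ij.2 * v ord_max ^+ (4 - ij.1 - ij.2)).
Proof.
move=> hF; rewrite [in LHS](homog_coefP hF) (perm_big _ quartic_monomials_perm).
rewrite big_map raddf_sum; apply: eq_bigr => -[i j] _ /=.
rewrite mevalZ mevalX !big_ord_recr big_ord0 /= mul1r; congr (_ * _).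
rewrite /mon !multinomE !(tnth_nth 0%N) /=.
by congr (v _ ^+ _ * v _ ^+ _ * v _ ^+ _); apply: val_inj; rewrite /=.
Qed.

Lemma homog_eq F G : F \is 4.-homog -> G \is 4.-homog ->
  (forall i j, (i, j) \in exponents -> F@_(mon i j) = G@_(mon i j)) -> F = G.
Proof.
move=> hF hG FG; apply/mpolyP => m; have [md|md] := eqVneq (mdeg m) 4%N.
  by have [i [j [ij ->]]] := mon_exponents md; apply: FG.
by rewrite (dhomog_nemf_coeff hF) ?(dhomog_nemf_coeff hG).
Qed.

End Homog.

(** * Inflection lines in coordinates adapted to the flag *)

(** The inverses of 4, 6 and 12 are arguments because the ring of coefficients will
    also be a polynomial ring, where they are constants. *)
Definition flex_of_coefs (R : nzRingType) (i4 i6 i12 : R) (c : nat -> nat -> R) : flex_form R :=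
  FlexForm (i4 * c 1%N 3%N) (c 0%N 4%N) (i4 * c 3%N 0%N) (i12 * c 2%N 1%N) (i12 * c 1%N 2%N)
    (i4 * c 0%N 3%N) (i6 * c 2%N 0%N) (i12 * c 1%N 1%N) (i6 * c 0%N 2%N) (i4 * c 1%N 0%N)
    (i4 * c 0%N 1%N) (c 0%N 0%N).

Definition flex_eval (R : comNzRingType) (f : flex_form R) (x y z : R) : R :=
  let: FlexForm a b l m s r n q c h k e := f in
  4 * a * x * y ^+ 3 + b * y ^+ 4
  + (4 * l * x ^+ 3 + 12 * m * x ^+ 2 * y + 12 * s * x * y ^+ 2 + 4 * r * y ^+ 3) * z
  + (6 * n * x ^+ 2 + 12 * q * x * y + 6 * c * y ^+ 2) * z ^+ 2
  + (4 * h * x + 4 * k * y) * z ^+ 3 + e * z ^+ 4.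

Section Frame.
Variable K : numFieldType.
Implicit Types (F G : {mpoly K[3]}) (P : 'M[K]_3) (L l p q y : 'rV[K]_3).

Lemma on_lineE l p : on_line l p <-> l *m p^T = 0.
Proof.
have E : (l *m p^T) 0 0 = \sum_(i < 3) l 0 i * p 0 i.
  by rewrite mxE; apply: eq_bigr => k _; rewrite mxE.
rewrite /on_line -E; split=> [l0|->]; last by rewrite mxE.
by apply/matrixP => i j; rewrite !ord1 l0 mxE.
Qed.

Lemma bquart_dual_line (f : flex_form K) u v s t :
  flex_eval f s t (u * s + v * t) = bquart (on_dual_line f u v) s t.
Proof. by case: f => *; rewrite /bquart /=; ring. Qed.

Lemma dvdp_X3 (r : {poly K}) c : (forall t, r.[t] = bquart c 1 t) ->
  'X^3 %| r <-> forall i, (i < 3)%N -> c i = 0.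
Proof.
move=> rE; pose r' := (c 0%N)%:P + (4 * c 1%N)%:P * 'X + (6 * c 2%N)%:P * 'X^2
   + ((4 * c 3%N)%:P + (c 4%N)%:P * 'X) * 'X^3.
have -> : r = r'.
  apply/eqP; rewrite -subr_eq0; apply/eqP/poly_fun_eq0 => t.
  rewrite hornerD hornerN rE /r' !(hornerXn, hornerD, hornerM, hornerC, hornerX) /bquart; ring.
split=> [/dvdpP[s sE] i i3|c0].
  have : r'`_i = 0 by rewrite sE coefMXn i3.
  have nz4 : 4 != 0 :> K by rewrite pnatr_eq0.
  have nz6 : 6 != 0 :> K by rewrite pnatr_eq0.
  rewrite /r' !coefD [(_ * 'X^3)`_i]coefMXn i3 !coefCM coefX coefXn coefC addr0.
  case: i i3 => [|[|[|]]] //= _; rewrite ?mulr0 ?mulr1 ?addr0 ?add0r //.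
    by move/eqP; rewrite mulf_eq0 (negPf nz4) => /eqP.
  by move/eqP; rewrite mulf_eq0 (negPf nz6) => /eqP.
by rewrite /r' (c0 0%N) // (c0 1%N) // (c0 2) // !mulr0 !mul0r !add0r dvdp_mull.
Qed.

Lemma restrict_horner F p q t :
  (restrict_to_line F p q).[t] = F.@[fun i => (p + t *: q) 0 i].
Proof.
rewrite /restrict_to_line /mmap horner_sum mevalE; apply: eq_bigr => m _.
rewrite hornerM hornerC /mmap1 horner_prod; congr (_ * _); apply: eq_bigr => i _.
by rewrite horner_exp !hornerE !mxE mulrC.
Qed.

(** In the basis formed by the rows of P, the point p is (1 : 0 : 0) and the line L
    is x2 = 0. *)
Definition frame L p P := [/\ P \in unitmx, row 0 P = p &
  forall y, on_line L (y *m P) <-> y 0 ord_max = 0].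

Lemma sum_ord3 (V : nmodType) (f : 'I_3 -> V) :
  \sum_(i < 3) f i = f 0 + f 1 + f ord_max.
Proof.
rewrite !big_ord_recr big_ord0 /= add0r.
by congr (f _ + f _ + f _); apply: val_inj.
Qed.

Lemma frame_exists L p : L != 0 -> p != 0 -> on_line L p -> exists P, frame L p P.
Proof.
move=> L0 p0 Lp.
have rkL : \rank L^T = 1%N by rewrite mxrank_tr rank_rV L0.
have [i qi] : exists i, ~~ (row i (kermx L^T) <= p)%MS.
  apply/row_subPn/negP => /mxrankS; rewrite mxrank_ker rkL rank_rV.
  by case: (p != 0).
set q := row i (kermx L^T) in qi.
have Lq : L *m q^T = 0.
  by apply: trmx_inj; rewrite trmx_mul trmxK trmx0 /q -row_mul mulmx_ker row0.
have /rV0Pn[k Lk] := L0.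
pose e : 'rV[K]_3 := delta_mx 0 k.
pose P : 'M[K]_3 := \matrix_(j < 3) [tuple p; q; e]`_j.
have PE y : y *m P = y 0 0 *: p + y 0 1 *: q + y 0 ord_max *: e.
  by rewrite mulmx_sum_row sum_ord3 !rowK.
have LE y : L *m (y *m P)^T = (y 0 ord_max * L 0 k)%:M.
  rewrite PE !(linearD, linearZ) /= Lq ((on_lineE _ _).1 Lp).
  rewrite !scaler0 !add0r; apply/matrixP => a b; rewrite !ord1 !mxE eqxx mulr1n.
  by congr (_ * _); rewrite (bigD1 k) //= big1 => [|c ck]; rewrite !mxE ?eqxx ?(negPf ck) ?mulr1 ?addr0 ?mulr0.
have Lfr y : on_line L (y *m P) <-> y 0 ord_max = 0.
  rewrite on_lineE LE; split=> [/matrixP/(_ 0 0)|->]; last by rewrite mul0r raddf0.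
  by rewrite !mxE eqxx mulr1n => /eqP; rewrite mulf_eq0 (negPf Lk) orbF => /eqP.
exists P; split=> //; last first.
  by rewrite rowK.
rewrite unitmxE unitfE; apply/negP => /det0P[y y0 yP].
have y2 : y 0 ord_max = 0 by apply/Lfr; rewrite yP on_lineE trmx0 mulmx0.
move: yP; rewrite PE y2 scale0r addr0 => yP.
have [y1|y1] := eqVneq (y 0 1) 0.
  move/eqP: yP; rewrite y1 scale0r addr0 scaler_eq0 (negPf p0) orbF => /eqP y00.
  case/negP: y0; apply/eqP/rowP => j; rewrite mxE.
  by case: j => -[|[|[|j]]] // lj; [rewrite -[RHS]y00|rewrite -[RHS]y1|rewrite -[RHS]y2];
    congr (y 0 _); apply: val_inj.
case/negP: qi; apply/sub_rVP; exists (- (y 0 0 / y 0 1)).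
apply: (scalerI y1); rewrite scalerA mulrN mulrCA divff // mulr1 scaleNr.
by apply/eqP; rewrite -addr_eq0 addrC yP.
Qed.

Variables (L p : 'rV[K]_3) (P : 'M[K]_3).
Hypothesis fP : frame L p P.

Definition coef_in P F i j := (F \mPo lin P)@_(mon i j).
Definition flex_of P F := flex_of_coefs (4^-1) (6^-1) (12^-1) (coef_in P F).

Lemma meval_frame F y : F.@[fun i => (y *m P) 0 i] = (F \mPo lin P).@[fun j => y 0 j].
Proof.
by rewrite lin_meval; apply: meval_eq => i; rewrite mxE; apply: eq_bigr => j _; rewrite mulrC.
Qed.

Lemma coef_eval F y : F \is 4.-homog -> let c := coef_in P F in
  F.@[fun i => (y *m P) 0 i] =
    c 4%N 0%N * y 0 0 ^+ 4 + c 3%N 1%N * y 0 0 ^+ 3 * y 0 1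
    + c 2%N 2%N * y 0 0 ^+ 2 * y 0 1 ^+ 2
    + flex_eval (flex_of P F) (y 0 0) (y 0 1) (y 0 ord_max).
Proof.
move=> hF /=; rewrite meval_frame (homog_meval _ (lin_homog _ hF)).
rewrite !big_cons big_nil /= -!/(coef_in P F _ _).
move: (coef_in P F) (y 0 0) (y 0 1) (y 0 ord_max) => c x0 x1 x2.
by field.
Qed.

End Frame.

Section Lines.
Variable K : numFieldType.
Implicit Types (F : {mpoly K[3]}) (l q y : 'rV[K]_3).
Variables (L p : 'rV[K]_3) (P : 'M[K]_3).
Hypothesis fP : frame L p P.

Let uP : P \in unitmx. Proof. by case: fP. Qed.

Definition row3 (x y z : K) : 'rV[K]_3 := \row_j [tuple x; y; z]`_j.

Lemma row3E (x y z : K) : (row3 x y z 0 0 = x) * (row3 x y z 0 1 = y) * (row3 x y z 0 ord_max = z).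
Proof. by rewrite !mxE. Qed.

Lemma row3_eta y : y = row3 (y 0 0) (y 0 1) (y 0 ord_max).
Proof.
by apply/rowP => -[[|[|[|j]]] // lj]; rewrite mxE /=; congr (y 0 _); apply: val_inj.
Qed.

Definition restricts_to F u v b := forall y, y 0 ord_max = u * y 0 0 + v * y 0 1 ->
  F.@[fun i => (y *m P) 0 i] = bquart b (y 0 0) (y 0 1).

Lemma restrict_bquart F u v b y y' t : restricts_to F u v b ->
  y 0 ord_max = u * y 0 0 + v * y 0 1 -> y' 0 ord_max = u * y' 0 0 + v * y' 0 1 ->
  (restrict_to_line F (y *m P) (y' *m P)).[t] =
    bquart (bquart_at b (y 0 0) (y 0 1) (y' 0 0) (y' 0 1)) 1 t.
Proof.
move=> Fb yl y'l; rewrite bquart_atE restrict_horner scalemxAl -mulmxDl Fb !mxE ?mul1r //.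
by rewrite yl y'l; ring.
Qed.

Lemma meets_bquart F u v b y y' : restricts_to F u v b ->
  y 0 ord_max = u * y 0 0 + v * y 0 1 -> y' 0 ord_max = u * y' 0 0 + v * y' 0 1 ->
  'X^3 %| restrict_to_line F (y *m P) (y' *m P) <->
  forall i, (i < 3)%N -> bquart_at b (y 0 0) (y 0 1) (y' 0 0) (y' 0 1) i = 0.
Proof. by move=> Fb yl y'l; apply: dvdp_X3 => t; apply: restrict_bquart Fb yl y'l. Qed.

Lemma sub_frame y y' : (y' *m P <= y *m P)%MS -> exists a, y' = a *: y.
Proof.
move/sub_rVP => [a]; rewrite scalemxAl => /(congr1 (mulmx^~ (invmx P))).
by rewrite !mulmxK // => ->; exists a.
Qed.

(** The line x2 = u x0 + v x1 in the basis P. *)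
Definition dual_line u v : 'rV[K]_3 := row3 u v (-1) *m (invmx P)^T.

Lemma on_dual_lineP u v y :
  on_line (dual_line u v) (y *m P) <-> y 0 ord_max = u * y 0 0 + v * y 0 1.
Proof.
rewrite on_lineE /dual_line trmx_mul mulmxA -[_ *m (invmx P)^T *m _]mulmxA -trmx_mul.
rewrite mulmxV // trmx1 mulmx1.
have E : (row3 u v (-1) *m y^T) 0 0 = u * y 0 0 + v * y 0 1 - y 0 ord_max.
  by rewrite mxE sum_ord3 !row3E !mxE mulN1r.
split=> [/matrixP/(_ 0 0)|yE]; first by rewrite E mxE => /subr0_eq ->.
by apply/matrixP => i j; rewrite !ord1 E yE subrr mxE.
Qed.

Lemma dual_line_neq0 u v : dual_line u v != 0.
Proof.
apply/eqP => /(congr1 (mulmx^~ P^T)); rewrite /dual_line mul0mx -mulmxA -trmx_mul.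
rewrite mulmxV // trmx1 mulmx1 => /rowP/(_ ord_max); rewrite row3E mxE => /eqP.
by rewrite oppr_eq0 oner_eq0.
Qed.

(** From left to right, the point and any other point of the line form a basis in
    which the first three coefficients of b vanish, and the invariants only
    change by a power of the determinant. *)
Lemma inflection_lineP F u v b : restricts_to F u v b ->
  is_inflection_line F (dual_line u v) <-> quartic_I b = 0 /\ quartic_J b = 0.
Proof.
move=> Fb; split=> [[p' [_ p'0 lp' mult]]|[I0 J0]].
  pose y := p' *m invmx P; have p'E : p' = y *m P by rewrite mulmxKV.
  rewrite {}p'E in p'0 lp' mult; move/on_dual_lineP: lp' => yl.
  pose x' : K := if y 0 0 == 0 then 1 else 0; pose y' : K := if y 0 0 == 0 then 0 else 1.
  have det0 : y 0 0 * y' - y 0 1 * x' != 0.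
    rewrite /x' /y'; have [y00|] := eqVneq (y 0 0) 0; last by rewrite mulr0 mulr1 subr0.
    rewrite mulr0 mulr1 sub0r oppr_eq0; apply: contraNneq p'0 => y1.
    by rewrite [y]row3_eta yl y00 y1 !mulr0 addr0 (_ : row3 0 0 0 = 0) ?mul0mx //;
      apply/rowP => -[[|[|[|j]]] // lj]; rewrite !mxE.
  pose w := row3 x' y' (u * x' + v * y').
  have wl : w 0 ord_max = u * w 0 0 + v * w 0 1 by rewrite !row3E.
  have nsub : ~~ (w *m P <= y *m P)%MS.
    apply: contra det0 => /sub_frame[a wE]; have [w0 w1] : w 0 0 = x' /\ w 0 1 = y' by rewrite !row3E.
    by rewrite -w0 -w1 wE !mxE; apply/eqP; ring.
  have /(meets_bquart Fb yl wl) := mult _ ((on_dual_lineP _ _ _).2 wl) nsub.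
  by rewrite !row3E; apply: triple_root_invariants.
have [x [z [m [n [xz bE]]]]] := invariants_triple_root I0 J0.
pose y := row3 x z (u * x + v * z).
have yl : y 0 ord_max = u * y 0 0 + v * y 0 1 by rewrite !row3E.
exists (y *m P); split; first exact: dual_line_neq0.
- apply/eqP => /(congr1 (mulmx^~ (invmx P))); rewrite mulmxK // mul0mx => y0.
  have xE : x = y 0 0 by rewrite row3E.
  have zE : z = y 0 1 by rewrite row3E.
  by move: xz; rewrite xE zE y0 !mxE eqxx.
- exact/on_dual_lineP.
move=> q; rewrite -[q](mulmxKV uP); set w := q *m _ => /on_dual_lineP wl _.
apply/(meets_bquart Fb yl wl) => i i3; rewrite !row3E.
suff : 'X^3 %| restrict_to_line F (y *m P) (w *m P).
  by move/(meets_bquart Fb yl wl)/(_ i i3); rewrite !row3E.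
pose D := w 0 0 * z - w 0 1 * x.
suff -> : restrict_to_line F (y *m P) (w *m P) =
    ((D ^+ 3 * (m * x + n * z))%:P + (D ^+ 3 * (m * w 0 0 + n * w 0 1))%:P * 'X) * 'X^3.
  exact: dvdp_mulIr.
apply/eqP; rewrite -subr_eq0; apply/eqP/poly_fun_eq0 => t.
rewrite hornerD hornerN (restrict_bquart _ Fb yl wl) bquart_atE bE !row3E.
rewrite !(hornerXn, hornerD, hornerM, hornerC, hornerX) /D; ring.
Qed.

Lemma restricts_to_flag F : F \is 4.-homog -> restricts_to F 0 0 (fun i => match i with
  | 0 => coef_in P F 4 0 | 1 => coef_in P F 3 1 / 4 | 2 => coef_in P F 2 2 / 6
  | 3 => f130 (flex_of P F) | _ => f040 (flex_of P F) end).
Proof.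
move=> hF y; rewrite !mul0r addr0 => yE; rewrite (coef_eval _ _ hF) yE.
by case: (flex_of P F) => a b *; rewrite /bquart /=; field.
Qed.

Lemma flex_conditions F : F \is 4.-homog ->
  meets_with_mult_ge 3 F L p <->
  [/\ coef_in P F 4 0 = 0, coef_in P F 3 1 = 0 & coef_in P F 2 2 = 0].
Proof.
move=> hF; have [_ pE LP] := fP; have Fb := restricts_to_flag hF.
have pE' : p = row3 1 0 0 *m P.
  by rewrite mulmx_sum_row sum_ord3 !row3E !scale0r !addr0 scale1r.
have pl : row3 1 0 0 0 ord_max = 0 * row3 1 0 0 0 0 + 0 * row3 1 0 0 0 1.
  by rewrite !row3E !mul0r addr0.
split=> [mult|[c40 c31 c22]].
  have ql : row3 0 1 0 0 ord_max = 0 * row3 0 1 0 0 0 + 0 * row3 0 1 0 0 1.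
    by rewrite !row3E !mul0r addr0.
  have nsub : ~~ (row3 0 1 0 *m P <= row3 1 0 0 *m P)%MS.
    apply/negP => /sub_frame[a /rowP/(_ 1)/eqP].
    by rewrite !mxE /= mulr0 oner_eq0.
  have Lq : on_line L (row3 0 1 0 *m P) by apply/LP; rewrite row3E.
  rewrite pE' in mult; have /(meets_bquart Fb pl ql) c0 := mult _ Lq nsub.
  rewrite !row3E in c0.
  have nz4 : 4 != 0 :> K by rewrite pnatr_eq0.
  have nz6 : 6 != 0 :> K by rewrite pnatr_eq0.
  split.
  - by rewrite -[RHS](c0 0%N) //= /bquart; ring.
  - by apply: (mulIf (invr_neq0 nz4)); rewrite mul0r -[RHS](c0 1%N) //=; ring.
  - by apply: (mulIf (invr_neq0 nz6)); rewrite mul0r -[RHS](c0 2%N) //=; ring.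
move=> q Lq _; rewrite pE' -[q](mulmxKV uP); set w := q *m _.
have wl : w 0 ord_max = 0 * w 0 0 + 0 * w 0 1.
  by rewrite !mul0r addr0; apply/LP; rewrite mulmxKV.
apply/(meets_bquart Fb pl wl) => i; rewrite !row3E c40 c31 c22.
by case: i => [|[|[|i]]] //= _; rewrite /bquart; ring.
Qed.

End Lines.

(** * Quartics with the same inflection lines *)

Section Forms.
Variable K : numClosedFieldType.
Implicit Types f : flex_form K.

Definition scale_flex (c : K) f := map_flex ( *%R c) f.

Lemma s_coef_scale c f i j : s_coef (scale_flex c f) i j = c ^+ 2 * s_coef f i j.
Proof.
case: f => a b l m s r n q c' h k e.
by case: i j => [|[|[|[|[|i]]]]] [|[|[|[|[|j]]]]] /=; ring.
Qed.

Lemma s_coef_out f i j : (4 < i + j)%N -> s_coef f i j = 0.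
Proof.
by case: f => ? ? ? ? ? ? ? ? ? ? ? ?; case: i j => [|[|[|[|[|i]]]]] [|[|[|[|[|j]]]]].
Qed.

(** The factor k is nonzero: otherwise S2 = 0, so every zero of T2 is one of the
    finitely many points S1 = T1 = 0.  As T2 has a zero on almost no vertical line,
    it is constant along them, and since it vanishes at the point (0, 0), which
    stands for the flex line L itself, it vanishes on the whole line u = 0; but S1
    does not. *)
Lemma same_zeros_S f1 f2 : generic_flexes f1 != 0 ->
  (forall u v, (flex_S f1).[v%:P].[u] = 0 /\ (flex_T f1).[v%:P].[u] = 0 <->
               (flex_S f2).[v%:P].[u] = 0 /\ (flex_T f2).[v%:P].[u] = 0) ->
  exists2 k, k != 0 & forall i j, s_coef f2 i j = k * s_coef f1 i j.
Proof.
move=> gen same; have /andP[Rsqf S0sqf] : (leadres 24 23 (flex_R f1) (flex_R f1)^`() != 0)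
    && (leadres 4 3 (S_at0 (s_coef f1)) (S_at0 (s_coef f1))^`() != 0).
  by rewrite -negb_or -mulf_eq0.
have [k kE] : exists k, forall i j, (i + j <= 4)%N -> s_coef f2 i j = k * s_coef f1 i j.
  apply: (@curve_multiple _ 4 6 _ _ _ isT isT Rsqf S0sqf) => u v S1 T1.
  by case: ((same u v).1 (conj S1 T1)).
have {}kE i j : s_coef f2 i j = k * s_coef f1 i j.
  by have [/kE //|out] := leqP (i + j) 4; rewrite !s_coef_out ?mulr0.
exists k => //; apply/eqP => k0.
have S2 : flex_S f2 = 0.
  apply/polyP => j; rewrite coef_bipoly coef0; case: ifP => // _.
  by apply/polyP => i; rewrite coef_poly coef0 kE k0 mul0r if_same.
have T2S1 u v : (flex_T f2).[v%:P].[u] = 0 -> (flex_S f1).[v%:P].[u] = 0 /\ (flex_T f1).[v%:P].[u] = 0.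
  by move=> T2; apply/same; rewrite S2 !horner0.
have R0 : flex_R f1 != 0.
  by apply: contraNneq Rsqf => ->; rewrite /leadres coef0 !mul0r.
have s04 : s_coef f1 0 4 != 0.
  by apply: contraNneq R0 => s0; rewrite /flex_R /leadres coef_bipoly_lead s0 !mul0r.
have t06 : t_coef f1 0 6 != 0.
  by apply: contraNneq R0 => t0; rewrite /flex_R /leadres !coef_bipoly_lead t0 mulr0 !mul0r.
have T2const j : (0 < j)%N -> (flex_T f2)`_j = 0.
  move=> j0; apply/eqP; rewrite -(mulIr_eq0 _ (mulIf R0)); apply/eqP/poly_fun_eq0 => u.
  rewrite hornerM; have [->|Ru] := eqVneq (flex_R f1).[u] 0; first by rewrite mulr0.
  suff : (map_poly (horner_eval u) (flex_T f2))`_j = 0.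
    by rewrite coef_map /= horner_evalE => ->; rewrite mul0r.
  apply: nth_default; have [/eqP->//|/closed_rootP[v]] := boolP (size (map_poly (horner_eval u) (flex_T f2)) == 1%N).
  rewrite rootE -horner2_map => /eqP/T2S1 ST; case/negP: Ru.
  rewrite /flex_R /leadres !hornerM (_ : (resultant _ _).[u] = 0) ?mulr0 //.
  by apply/(resultant_bipoly_root u s04 t06); exists v.
have T20 v : (flex_T f2).[v%:P].[0] = 0.
  have -> : flex_T f2 = ((flex_T f2)`_0)%:P.
    by apply/polyP => j; rewrite coefC; case: j => // j; rewrite T2const.
  rewrite hornerC horner_coef0 coef_bipoly /= coef_poly /=.
  by case: (f2).
have S10 : S_at0 (s_coef f1) = 0.
  apply: poly_fun_eq0 => v; have [S10 _] := T2S1 0 v (T20 v).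
  rewrite -[RHS]S10 horner2_map; congr (_.[v]).
  apply/polyP => j; rewrite coef_map /= horner_evalE horner_coef0 coef_bipoly coef_poly ltnS.
  by case: ifP => _; rewrite ?coef0 ?coef_poly.
by case/negP: S0sqf; rewrite S10 /leadres coef0 !mul0r.
Qed.

(** S is quadratic in the form, so a square root of the factor makes S equal. *)
Lemma recover_flex_form f1 f2 : generic_flexes f1 != 0 -> generic_recovery f1 != 0 ->
  (forall u v, (flex_S f1).[v%:P].[u] = 0 /\ (flex_T f1).[v%:P].[u] = 0 <->
               (flex_S f2).[v%:P].[u] = 0 /\ (flex_T f2).[v%:P].[u] = 0) ->
  exists2 c, c != 0 & f2 = scale_flex c f1.
Proof.
move=> g1 g2 same; have [k k0 kE] := same_zeros_S g1 same.
pose c := sqrtC k^-1; have c2 : c ^+ 2 = k^-1 by rewrite sqrtCK.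
have c0 : c != 0 by apply: contraNneq (invr_neq0 k0) => c0; rewrite -c2 c0 expr0n.
have [E|E] : scale_flex c f2 = f1 \/ scale_flex c f2 = opp_flex f1.
  by apply: recover_from_S => // i j; rewrite s_coef_scale kE c2 mulKf.
- exists c^-1; first by rewrite invr_eq0.
  by rewrite -E; case: (f2) => *; rewrite /scale_flex /= !mulKf.
exists (- c^-1); first by rewrite oppr_eq0 invr_eq0.
have -> : f1 = opp_flex (scale_flex c f2) by rewrite E; case: (f1) => * /=; rewrite /opp_flex /= !opprK.
by case: (f2) => *; rewrite /scale_flex /opp_flex /= !mulrNN !mulKf.
Qed.

End Forms.

(** * The open set *)

Lemma meval_homog_scale (K : comNzRingType) n (g : {mpoly K[n]}) d (t : K) v :
  g \is d.-homog -> g.@[fun i => t * v i] = t ^+ d * g.@[v].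
Proof.
move=> /dhomogP hg; rewrite !mevalE mulr_sumr [LHS]big_seq [RHS]big_seq.
apply: eq_bigr => m /hg /= <-; rewrite mdegE -prodrXr mulrCA -big_split /=.
by congr (_ * _); apply: eq_bigr => i _; rewrite exprMn.
Qed.

Lemma meval_scale_components (K : comNzRingType) n (g : {mpoly K[n]}) (t : K) v :
  g.@[fun i => t * v i] = (\poly_(d < msize g) (pihomog mdeg d g).@[v]).[t].
Proof.
rewrite horner_poly {1}(pihomog_partitionE (leqnn (msize g))) raddf_sum /=.
apply: eq_bigr => d _; rewrite (meval_homog_scale _ _ (pihomogP _ _ _)) mulrC //.
Qed.

Section Generic.
Variable K : numClosedFieldType.
Variables (L p : 'rV[K]_3) (P : 'M[K]_3).
Hypothesis fP : frame L p P.
Implicit Types F : {mpoly K[3]}.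

Local Notation V := (quartics_with_flex L p).

(** The coefficients in the basis P as linear forms in the 15 coordinates of a
    quartic. *)
Definition univ_coef i j : {mpoly K[15]} :=
  \sum_(k < 15) ('X_[nth 0%MM quartic_monomials k] \mPo lin P)@_(mon i j) *: 'X_k.
Definition univ_flex : flex_form {mpoly K[15]} :=
  flex_of_coefs (4^-1)%:MP (6^-1)%:MP (12^-1)%:MP univ_coef.
Definition genericity : {mpoly K[15]} :=
  generic_flexes univ_flex * generic_recovery univ_flex.

Lemma univ_coefE F i j : F \is 4.-homog ->
  (univ_coef i j).@[quartic_coord F] = coef_in P F i j.
Proof.
move=> hF; rewrite /univ_coef /coef_in [in RHS](homog_coefP hF).
rewrite (raddf_sum (comp_mpoly (lin P))) (raddf_sum (mcoeff (mon i j))).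
rewrite (raddf_sum (meval _)) (big_nth 0%MM) size_basis big_mkord /=.
by apply: eq_bigr => k _; rewrite mevalZ mevalXU comp_mpolyZ mcoeffZ mulrC.
Qed.

Lemma univ_flexE F : F \is 4.-homog ->
  map_flex (meval (quartic_coord F)) univ_flex = flex_of P F.
Proof.
move=> hF; have E i j : (univ_coef i j).@[quartic_coord F] = coef_in P F i j.
  exact: univ_coefE.
rewrite /univ_flex /flex_of; move: univ_coef (coef_in P F) E => c c' E.
by rewrite /flex_of_coefs /map_flex !mevalM !mevalC !E.
Qed.

Lemma genericityE F : F \is 4.-homog -> genericity.@[quartic_coord F] =
  generic_flexes (flex_of P F) * generic_recovery (flex_of P F).
Proof.
move=> hF; rewrite mevalM -(univ_flexE hF); congr (_ * _).
  exact: (map_generic_flexes (meval (quartic_coord F))).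
exact: (map_generic_recovery (meval (quartic_coord F))).
Qed.

Definition determined F := forall F', V F' -> same_inflection_lines F F' -> same_curve F F'.

Lemma inflection_line_ST F u v : V F ->
  is_inflection_line F (dual_line P u v) <->
  (flex_S (flex_of P F)).[v%:P].[u] = 0 /\ (flex_T (flex_of P F)).[v%:P].[u] = 0.
Proof.
move=> [[_ hF] /(flex_conditions fP hF)[c40 c31 c22]].
rewrite horner_flex_S horner_flex_T; apply: (inflection_lineP fP) => y yl.
by rewrite (coef_eval _ _ hF) c40 c31 c22 !mul0r !add0r yl bquart_dual_line.
Qed.

Lemma flex_of_coefs_scale (x x' : nat -> nat -> K) c :
  [/\ x 4%N 0%N = 0, x 3%N 1%N = 0 & x 2%N 2%N = 0] ->
  [/\ x' 4%N 0%N = 0, x' 3%N 1%N = 0 & x' 2%N 2%N = 0] ->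
  flex_of_coefs (4^-1) (6^-1) (12^-1) x' = scale_flex c (flex_of_coefs (4^-1) (6^-1) (12^-1) x) ->
  forall i j, (i, j) \in exponents -> x' i j = c * x i j.
Proof.
move=> [c40 c31 c22] [c40' c31' c22'] []; rewrite !(mulrCA c).
have nz n : (n.+1%:R : K)^-1 != 0 by rewrite invr_eq0 pnatr_eq0.
move=> /(mulfI (nz _)) e1 e2 /(mulfI (nz _)) e3 /(mulfI (nz _)) e4 /(mulfI (nz _)) e5.
move=> /(mulfI (nz _)) e6 /(mulfI (nz _)) e7 /(mulfI (nz _)) e8 /(mulfI (nz _)) e9.
move=> /(mulfI (nz _)) e10 /(mulfI (nz _)) e11 e12 i j; rewrite !inE.
do 14 (case/orP; first by case/eqP=> -> ->; rewrite ?c40 ?c31 ?c22 ?c40' ?c31' ?c22' ?mulr0).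
by case/eqP=> -> ->.
Qed.

Lemma flex_of_scale F F' c : V F -> V F' -> flex_of P F' = scale_flex c (flex_of P F) ->
  F' = c *: F.
Proof.
move=> [[_ hF] /(flex_conditions fP hF) cF] [[_ hF'] /(flex_conditions fP hF') cF'] E.
have key := flex_of_coefs_scale cF cF' E; have [uP _ _] := fP.
rewrite -(lin_comp F' (mulVmx uP)) -[F in RHS](lin_comp F (mulVmx uP)).
rewrite -comp_mpolyZ; congr (_ \mPo _).
apply: homog_eq; rewrite ?rpredZ ?lin_homog // => i j /key.
by rewrite mcoeffZ.
Qed.

Lemma generic_determined F : V F -> genericity.@[quartic_coord F] != 0 -> determined F.
Proof.
move=> VF; rewrite (genericityE VF.1.2) mulf_eq0 negb_or => /andP[g1 g2] F' VF' same.
have [u v|c c0 E] := recover_flex_form (f2 := flex_of P F') g1 g2.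
  have iF := inflection_line_ST u v VF; have iF' := inflection_line_ST u v VF'.
  by split=> [/iF/same/iF'|/iF'/same/iF].
by exists c => //; apply: flex_of_scale.
Qed.

Lemma determined_scale F t : t != 0 -> determined (t *: F) -> determined F.
Proof.
move=> t0 det F' VF' same.
have restrict_scale q q' : restrict_to_line (t *: F) q q' = t%:P * restrict_to_line F q q'.
  by rewrite /restrict_to_line mmapZ.
have meets_scale m l q : meets_with_mult_ge m (t *: F) l q <-> meets_with_mult_ge m F l q.
  by split=> mF q' lq' nq'; move: (mF q' lq' nq'); rewrite restrict_scale mul_polyC dvdpZr.
have flex_scale l : is_inflection_line (t *: F) l <-> is_inflection_line F l.
  by split=> -[q [l0 q0 lq mq]]; exists q; split=> //;
    [exact: (meets_scale _ _ _).1 mq|exact: (meets_scale _ _ _).2 mq].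
have [c c0 E] : same_curve (t *: F) F'.
  apply: det => // l; split; first by move/flex_scale/same.
  by move/same/flex_scale.
by exists (c * t); rewrite ?mulf_neq0 // -scalerA.
Qed.

Lemma quartic_coord_scale F t i : quartic_coord (t *: F) i = t * quartic_coord F i.
Proof. by rewrite /quartic_coord mcoeffZ. Qed.

Lemma quartics_with_flex_scale F t : t != 0 -> V F -> V (t *: F).
Proof.
move=> t0 [[F0 hF] mF]; split; first by split; rewrite ?scaler_eq0 ?negb_or ?t0 ?rpredZ.
move=> q lq nq; rewrite /restrict_to_line mmapZ mul_polyC dvdpZr //.
exact: mF.
Qed.

(** Along the line of multiples t F, the genericity polynomial is a polynomial in t
    whose coefficients are the values of its homogeneous components at F.  If one
    of them is nonzero, some multiple of F with t nonzero is generic, and being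
    determined is invariant under scaling. *)
Lemma component_determined F d : V F ->
  (pihomog mdeg d genericity).@[quartic_coord F] != 0 -> determined F.
Proof.
move=> VF gd; pose r := \poly_(e < msize genericity) (pihomog mdeg e genericity).@[quartic_coord F].
(* The factor 'X makes sure that the t found is nonzero. *)
have r0 : 'X * r != 0.
  rewrite mulf_neq0 ?polyX_eq0 //; apply/eqP => /polyP/(_ d); rewrite coef_poly coef0.
  case: ifP => [_ /eqP|/negbT]; first by rewrite (negPf gd).
  rewrite -leqNgt => dm _; case/negP: gd.
  rewrite pihomogE big_seq_cond big1 ?meval0 // => m /andP[/msize_mdeg_lt lt /eqP md].
  by move: dm; rewrite leqNgt -md lt.
have [t rt] := poly_nonroot r0.
move: rt; rewrite hornerM hornerX mulf_eq0 negb_or => /andP[t0 rt].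
apply: (determined_scale t0); apply: generic_determined; first exact: quartics_with_flex_scale.
by rewrite (meval_eq _ (quartic_coord_scale F t)) meval_scale_components.
Qed.

Definition sample_int : flex_form int := FlexForm 1 0 1 0 0 0 0 1 1 1 0 1.

Definition sample_coef i j : K := match i, j with
  | 1, 3 => 4 | 3, 0 => 4 | 1, 1 => 12 | 0, 2 => 6 | 1, 0 => 4 | 0, 0 => 1 | _, _ => 0 end.

Definition sample_quartic : {mpoly K[3]} :=
  (\sum_(ij <- exponents) sample_coef ij.1 ij.2 *: 'X_[mon ij.1 ij.2]) \mPo lin (invmx P).

Lemma sample_coefE i j : (i, j) \in exponents -> coef_in P sample_quartic i j = sample_coef i j.
Proof.
have [uP _ _] := fP; move=> ijE; rewrite /coef_in /sample_quartic lin_comp ?mulmxV //.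
rewrite raddf_sum /= (bigD1_seq (i, j)) //= mcoeffZ mcoeffX eqxx mulr1.
rewrite big1 ?addr0 // => -[a b] /= ab; rewrite mcoeffZ mcoeffX.
case: eqP => [E|]; last by rewrite mulr0.
by case/eqP: ab; move: (monE a b).1; rewrite E !monE => -[-> ->].
Qed.

Lemma sample_in_V : V sample_quartic.
Proof.
have h : sample_quartic \is 4.-homog.
  apply: lin_homog; rewrite big_seq; apply: rpred_sum => -[i j] /exponents_le ij; apply: rpredZ.
  by rewrite dhomogX /= mdeg_mon.
split; last by apply/(flex_conditions fP h); rewrite !sample_coefE.
split=> //; apply/eqP => s0; have := @sample_coefE 0 0 isT.
by rewrite s0 /coef_in comp_mpoly0 mcoeff0 => /esym/eqP; rewrite oner_eq0.
Qed.

Lemma sample_generic : genericity.@[quartic_coord sample_quartic] != 0.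
Proof.
rewrite (genericityE sample_in_V.1.2).
have -> : flex_of P sample_quartic = map_flex (intmul 1) sample_int.
  by rewrite /flex_of /flex_of_coefs !sample_coefE //= !mulr0 !mulVf ?pnatr_eq0.
rewrite -map_generic_flexes -map_generic_recovery -rmorphM /= intr_eq0.
have sE : map_flex (intmul 1) sample_int = sample by [].
have flexes_int : (generic_flexes sample_int)%:~R = generic_flexes sample.
  by rewrite -sE; apply: map_generic_flexes.
have recovery_int : (generic_recovery sample_int)%:~R = generic_recovery sample.
  by rewrite -sE; apply: map_generic_recovery.
apply: mulf_neq0.
  by apply: contraNneq sample_flexes => g0; rewrite -flexes_int g0 mulr0z.
by apply: contraNneq sample_recovery => g0; rewrite -recovery_int g0 mulr0z.
Qed.

End Generic.

Theorem theorem1 (R : realType) (L p : 'rV[R[i]]_3)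
    (hL : L != 0) (hp : p != 0) (hpL : on_line L p) :
  exists U : {mpoly R[i][3]} -> Prop,
    zariski_open_in (quartics_with_flex L p) U /\
    (exists F, U F) /\
    (forall X1 X2 : {mpoly R[i][3]},
       is_smooth_plane_quartic X1 -> is_smooth_plane_quartic X2 ->
       is_inflection_line_at X1 L p -> is_inflection_line_at X2 L p ->
       U X1 -> same_inflection_lines X1 X2 ->
       same_curve X1 X2).
Proof.
have [P fP] := frame_exists hL hp hpL.
(* The open set is cut out by all the homogeneous forms that suffice, so a single
   homogeneous component of the genericity polynomial makes it nonempty. *)
pose S (g : {mpoly R[i][15]}) := g \is homog mdeg /\ forall F, quartics_with_flex L p F ->
  g.@[quartic_coord F] != 0 -> determined L p F.
exists (fun F => quartics_with_flex L p F /\ exists2 g, S g & g.@[quartic_coord F] != 0).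
split; first by exists S; split=> // g [].
split; last first.
  move=> X1 X2 _ [pX2 _] _ [_ _ _ mX2] [VX1 [g [_ gdet] gX1]].
  exact: (gdet _ VX1 gX1 X2 (conj pX2 mX2)).
have VF := sample_in_V fP; exists (sample_quartic P); split=> //.
have := sample_generic fP.
rewrite {1}(pihomog_partitionE (leqnn (msize (genericity P)))) raddf_sum /=.
case: (pickP (fun d : 'I_(msize (genericity P)) =>
   (pihomog mdeg d (genericity P)).@[quartic_coord (sample_quartic P)] != 0)) => [d gd _|all0].
  exists (pihomog mdeg d (genericity P)) => //; split; first exact: homogE (pihomogP _ _ _).
  by move=> F VF'; apply: component_determined.
by rewrite big1 ?eqxx // => d _; apply/eqP/negPn; rewrite all0.
Qed.
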